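(* Let $\mathcal{C}$ be a braided finite tensor category over a field $\Bbbk$. Every Hopf algebra in $\mathcal{C}$ is a quasi-Frobenius algebra in $\mathcal{C}$.
   Context: $\Bbbk$ is an arbitrary field. A finite abelian category is a $\Bbbk$-linear category equivalent to the category of finite-dimensional right modules over a finite-dimensional $\Bbbk$-algebra. A finite tensor category is a finite abelian category $\mathcal{C}$ with a rigid monoidal structure with bilinear $\otimes$ and simple unit object. For an algebra $A$ in $\mathcal{C}$, the category $\mathcal{C}_A$ of right $A$-modules in $\mathcal{C}$ is a left $\mathcal{C}$-module category by $X\triangleright M=X\otimes M$, and its internal Hom functor $\underline{\mathrm{Hom}}_A$ is defined by natural isomorphisms $\mathrm{Hom}_{\mathcal{C}_A}(X\otimes M,N)\cong\mathrm{Hom}_{\mathcal{C}}(X,\underline{\mathrm{Hom}}_A(M,N))$. An object $M\in\mathcal{C}_A$ is $\mathcal{C}$-injective if the functor $\underline{\mathrm{Hom}}_A(-,M)$ is exact. An algebra $A$ in $\mathcal{C}$ is quasi-Frobenius if the right $A$-module $A$ is $\mathcal{C}$-injective in $\mathcal{C}_A$. A Hopf algebra in a braided monoidal category is defined as usual using the braiding. *)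

(* Defs.v *)
From HB Require Import structures.
From mathcomp Require Import all_boot all_algebra all_field.
From mathcomp Require Import boolp.

Set Implicit Arguments.
Unset Strict Implicit.
Unset Printing Implicit Defensive.

Import GRing.Theory.
Local Open Scope ring_scope.

Declare Scope cat_scope.
Delimit Scope cat_scope with cat.
Reserved Notation "g \oc f" (at level 50, left associativity).
Reserved Notation "X \ox Y" (at level 40, left associativity).
Reserved Notation "f \om g" (at level 40, left associativity).

Record lincat (k : fieldType) := LinCat {
  obj :> Type;
  hom : obj -> obj -> lmodType k;
  idm : forall X, hom X X;
  comp : forall X Y Z, hom Y Z -> hom X Y -> hom X Z;
  comp1m : forall X Y (f : hom X Y), comp (idm Y) f = f;
  compm1 : forall X Y (f : hom X Y), comp f (idm X) = f;
  compA : forall X Y Z W (h : hom Z W) (g : hom Y Z) (f : hom X Y),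
    comp h (comp g f) = comp (comp h g) f;
  comp_linl : forall X Y Z (a : k) (g g' : hom Y Z) (f : hom X Y),
    comp (a *: g + g') f = a *: comp g f + comp g' f;
  comp_linr : forall X Y Z (a : k) (g : hom Y Z) (f f' : hom X Y),
    comp g (a *: f + f') = a *: comp g f + comp g f' }.

Arguments hom {k l} X Y.
Arguments idm {k l} X.
Arguments comp {k l X Y Z} g f.

Notation "g \oc f" := (comp g f) : cat_scope.
Local Open Scope cat_scope.

Lemma comp0m (k : fieldType) (C : lincat k) (X Y Z : C) (f : hom X Y) :
  (0 : hom Y Z) \oc f = 0.
Proof.
have := comp_linl (-1) (0 : hom Y Z) 0 f.
by rewrite scaler0 addr0 scaleN1r addNr.
Qed.

Lemma compm0 (k : fieldType) (C : lincat k) (X Y Z : C) (g : hom Y Z) :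
  g \oc (0 : hom X Y) = 0.
Proof.
have := comp_linr (-1) g (0 : hom X Y) 0.
by rewrite scaler0 addr0 scaleN1r addNr.
Qed.

Definition is_iso (k : fieldType) (C : lincat k) (X Y : C) (f : hom X Y) : Prop :=
  exists g : hom Y X, g \oc f = idm X /\ f \oc g = idm Y.

Definition mono (k : fieldType) (C : lincat k) (X Y : C) (f : hom X Y) : Prop :=
  forall (Z : C) (g h : hom Z X), f \oc g = f \oc h -> g = h.

(* In a k-linear category, X is a zero object if and only if its identity is
   the zero morphism. *)
Definition zero_obj (k : fieldType) (C : lincat k) (X : C) : Prop :=
  idm X = 0.

Definition simple_obj (k : fieldType) (C : lincat k) (X : C) : Prop :=
  ~ zero_obj X /\
  forall (Y : C) (i : hom Y X), mono i -> zero_obj Y \/ is_iso i.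

Definition is_kernel (k : fieldType) (C : lincat k) (K X Y : C)
    (f : hom K X) (g : hom X Y) : Prop :=
  g \oc f = 0 /\
  forall (Z : C) (h : hom Z X), g \oc h = 0 ->
    exists! t : hom Z K, f \oc t = h.

Definition is_cokernel (k : fieldType) (C : lincat k) (X Y Q : C)
    (g : hom Y Q) (f : hom X Y) : Prop :=
  g \oc f = 0 /\
  forall (Z : C) (h : hom Y Z), h \oc f = 0 ->
    exists! t : hom Q Z, t \oc g = h.

(* 0 -> X -> Y -> Z -> 0 is exact. *)
Definition short_exact (k : fieldType) (C : lincat k) (X Y Z : C)
    (f : hom X Y) (g : hom Y Z) : Prop :=
  is_kernel f g /\ is_cokernel g f.

Definition op (k : fieldType) (C : lincat k) : lincat k :=
  {| obj := C;
     hom := fun X Y => @hom k C Y X;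
     idm := fun X => @idm k C X;
     comp := fun X Y Z (g : @hom k C Z Y) (f : @hom k C Y X) => f \oc g;
     comp1m := fun X Y f => compm1 f;
     compm1 := fun X Y f => comp1m f;
     compA := fun X Y Z W h g f => esym (compA f g h);
     comp_linl := fun X Y Z a g g' f => comp_linr a f g g';
     comp_linr := fun X Y Z a g f f' => comp_linl a f f' g |}.

Record functor (k : fieldType) (C D : lincat k) := Functor {
  fobj :> C -> D;
  fmap : forall X Y : C, hom X Y -> hom (fobj X) (fobj Y);
  fmap_id : forall X : C, fmap (idm X) = idm (fobj X);
  fmap_comp : forall (X Y Z : C) (g : hom Y Z) (f : hom X Y),
    fmap (g \oc f) = fmap g \oc fmap f }.

Arguments fmap {k C D} F {X Y} f : rename.

Definition linear_functor (k : fieldType) (C D : lincat k)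
    (F : functor C D) : Prop :=
  forall (X Y : C) (a : k) (f g : hom X Y),
    fmap F (a *: f + g) = a *: fmap F f + fmap F g.

Definition additive_functor (k : fieldType) (C D : lincat k)
    (F : functor C D) : Prop :=
  forall (X Y : C) (f g : hom X Y), fmap F (f + g) = fmap F f + fmap F g.

Definition exact_functor (k : fieldType) (C D : lincat k)
    (F : functor C D) : Prop :=
  additive_functor F /\
  forall (X Y Z : C) (f : hom X Y) (g : hom Y Z),
    short_exact f g -> short_exact (fmap F f) (fmap F g).

Definition id_functor (k : fieldType) (C : lincat k) : functor C C :=
  {| fobj := fun X : C => X;
     fmap := fun (X Y : C) (f : hom X Y) => f;
     fmap_id := fun X => erefl;
     fmap_comp := fun X Y Z g f => erefl |}.

Lemma comp_functor_id (k : fieldType) (C D E : lincat k)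
    (G : functor D E) (F : functor C D) (X : C) :
  fmap G (fmap F (idm X)) = idm (G (F X)).
Proof. by rewrite !fmap_id. Qed.

Lemma comp_functor_comp (k : fieldType) (C D E : lincat k)
    (G : functor D E) (F : functor C D) (X Y Z : C)
    (g : hom Y Z) (f : hom X Y) :
  fmap G (fmap F (g \oc f)) = fmap G (fmap F g) \oc fmap G (fmap F f).
Proof. by rewrite !fmap_comp. Qed.

Definition comp_functor (k : fieldType) (C D E : lincat k)
    (G : functor D E) (F : functor C D) : functor C E :=
  {| fobj := fun X : C => G (F X);
     fmap := fun (X Y : C) (f : hom X Y) => fmap G (fmap F f);
     fmap_id := comp_functor_id G F;
     fmap_comp := comp_functor_comp G F |}.

Definition nat_isomorphic (k : fieldType) (C D : lincat k)
    (F G : functor C D) : Prop :=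
  exists eta : forall X : C, hom (F X) (G X),
    (forall X, is_iso (eta X)) /\
    (forall (X Y : C) (f : hom X Y), eta Y \oc fmap F f = fmap G f \oc eta X).

Definition equivalent (k : fieldType) (C D : lincat k) : Prop :=
  exists (F : functor C D) (G : functor D C),
    [/\ linear_functor F, linear_functor G,
        nat_isomorphic (comp_functor G F) (id_functor C) &
        nat_isomorphic (comp_functor F G) (id_functor D)].

Record fdmod (k : fieldType) (A : falgType k) := FdMod {
  fd_space :> vectType k;
  fd_act : fd_space -> A -> fd_space;
  fd_act_linl : forall (c : k) (v w : fd_space) (a : A),
    fd_act (c *: v + w) a = c *: fd_act v a + fd_act w a;
  fd_act_linr : forall (c : k) (v : fd_space) (a b : A),
    fd_act v (c *: a + b) = c *: fd_act v a + fd_act v b;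
  fd_act1 : forall v : fd_space, fd_act v 1 = v;
  fd_actM : forall (v : fd_space) (a b : A),
    fd_act v (a * b) = fd_act (fd_act v a) b }.

Definition fdhom_pred (k : fieldType) (A : falgType k) (M N : fdmod A) :
    pred 'Hom(M, N) :=
  fun f => `[< forall (v : M) (a : A), f (fd_act v a) = fd_act (f v) a >].

Lemma fdhom_submod_closed (k : fieldType) (A : falgType k) (M N : fdmod A) :
  GRing.submod_closed (fdhom_pred (M := M) (N := N)).
Proof.
have act0 (a : A) : fd_act (0 : N) a = 0.
  have := fd_act_linl (-1) (0 : N) 0 a.
  by rewrite scaler0 addr0 scaleN1r addNr.
split; first by apply/asboolP => v a; rewrite !lfunE /= act0.
move=> c f g /asboolP Hf /asboolP Hg; apply/asboolP => v a.
by rewrite !add_lfunE !scale_lfunE Hf Hg fd_act_linl.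
Qed.

HB.instance Definition _ (k : fieldType) (A : falgType k) (M N : fdmod A) :=
  GRing.isSubmodClosed.Build k 'Hom(M, N) (fdhom_pred (M := M) (N := N))
    (fdhom_submod_closed M N).

Record fdhom (k : fieldType) (A : falgType k) (M N : fdmod A) := FdHom {
  fdhom_val :> 'Hom(M, N);
  fdhom_valP : fdhom_val \in fdhom_pred (M := M) (N := N) }.

HB.instance Definition _ (k : fieldType) (A : falgType k) (M N : fdmod A) :=
  [isSub for @fdhom_val k A M N].
HB.instance Definition _ (k : fieldType) (A : falgType k) (M N : fdmod A) :=
  [Choice of fdhom M N by <:].
HB.instance Definition _ (k : fieldType) (A : falgType k) (M N : fdmod A) :=
  [SubChoice_isSubLmodule of fdhom M N by <:].

Lemma fdhom_idP (k : fieldType) (A : falgType k) (M : fdmod A) :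
  (\1%VF : 'Hom(M, M)) \in fdhom_pred (M := M) (N := M).
Proof. by apply/asboolP => v a; rewrite !id_lfunE. Qed.

Lemma fdhom_compP (k : fieldType) (A : falgType k) (M N P : fdmod A)
    (g : fdhom N P) (f : fdhom M N) :
  (fdhom_val g \o fdhom_val f)%VF \in fdhom_pred (M := M) (N := P).
Proof.
apply/asboolP => v a; rewrite !comp_lfunE.
have /asboolP -> := fdhom_valP f.
by have /asboolP -> := fdhom_valP g.
Qed.

Definition fdmod_cat (k : fieldType) (A : falgType k) : lincat k.
Proof.
refine {| obj := fdmod A;
          hom := fun M N => fdhom M N : lmodType k;
          idm := fun M => FdHom (fdhom_idP M);
          comp := fun M N P (g : fdhom N P) (f : fdhom M N) =>
                    FdHom (fdhom_compP g f) |}.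
- by move=> M N f; apply: val_inj; rewrite /= comp_lfun1l.
- by move=> M N f; apply: val_inj; rewrite /= comp_lfun1r.
- by move=> M N P Q h g f; apply: val_inj; rewrite /= comp_lfunA.
- move=> M N P a g g' f; apply: val_inj; rewrite /=.
  by rewrite comp_lfunDl comp_lfunZl.
- move=> M N P a g f f'; apply: val_inj; rewrite /=.
  by rewrite comp_lfunDr comp_lfunZr.
Defined.

(* An [falgType] is a nonzero algebra, so this definition omits the zero
   category; it cannot carry a simple object anyway. *)
Definition finite_abelian (k : fieldType) (C : lincat k) : Prop :=
  exists A : falgType k, equivalent C (fdmod_cat A).

Record moncat (k : fieldType) := MonCat {
  mon_cat :> lincat k;
  ten : mon_cat -> mon_cat -> mon_cat;
  tenm : forall X X' Y Y' : mon_cat,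
    hom X X' -> hom Y Y' -> hom (ten X Y) (ten X' Y');
  tenm_id : forall X Y : mon_cat, tenm (idm X) (idm Y) = idm (ten X Y);
  tenm_comp : forall (X X' X'' Y Y' Y'' : mon_cat)
      (f' : hom X' X'') (f : hom X X') (g' : hom Y' Y'') (g : hom Y Y'),
    tenm (f' \oc f) (g' \oc g) = tenm f' g' \oc tenm f g;
  tenm_linl : forall (X X' Y Y' : mon_cat) (a : k)
      (f f' : hom X X') (g : hom Y Y'),
    tenm (a *: f + f') g = a *: tenm f g + tenm f' g;
  tenm_linr : forall (X X' Y Y' : mon_cat) (a : k)
      (f : hom X X') (g g' : hom Y Y'),
    tenm f (a *: g + g') = a *: tenm f g + tenm f g';
  unit_obj : mon_cat;
  assoc : forall X Y Z : mon_cat, hom (ten (ten X Y) Z) (ten X (ten Y Z));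
  assocI : forall X Y Z : mon_cat, hom (ten X (ten Y Z)) (ten (ten X Y) Z);
  assocK : forall X Y Z, assocI X Y Z \oc assoc X Y Z = idm _;
  assocIK : forall X Y Z, assoc X Y Z \oc assocI X Y Z = idm _;
  assoc_nat : forall (X X' Y Y' Z Z' : mon_cat)
      (f : hom X X') (g : hom Y Y') (h : hom Z Z'),
    assoc X' Y' Z' \oc tenm (tenm f g) h = tenm f (tenm g h) \oc assoc X Y Z;
  lunit : forall X : mon_cat, hom (ten unit_obj X) X;
  lunitI : forall X : mon_cat, hom X (ten unit_obj X);
  lunitK : forall X, lunitI X \oc lunit X = idm _;
  lunitIK : forall X, lunit X \oc lunitI X = idm _;
  lunit_nat : forall (X Y : mon_cat) (f : hom X Y),
    lunit Y \oc tenm (idm unit_obj) f = f \oc lunit X;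
  runit : forall X : mon_cat, hom (ten X unit_obj) X;
  runitI : forall X : mon_cat, hom X (ten X unit_obj);
  runitK : forall X, runitI X \oc runit X = idm _;
  runitIK : forall X, runit X \oc runitI X = idm _;
  runit_nat : forall (X Y : mon_cat) (f : hom X Y),
    runit Y \oc tenm f (idm unit_obj) = f \oc runit X;
  pentagon : forall W X Y Z : mon_cat,
    assoc W X (ten Y Z) \oc assoc (ten W X) Y Z =
    tenm (idm W) (assoc X Y Z) \oc assoc W (ten X Y) Z
      \oc tenm (assoc W X Y) (idm Z);
  triangle : forall X Y : mon_cat,
    tenm (idm X) (lunit Y) \oc assoc X unit_obj Y = tenm (runit X) (idm Y) }.

Arguments ten {k m} X Y.
Arguments tenm {k m X X' Y Y'} f g.
Arguments unit_obj {k} m.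
Arguments assoc {k m} X Y Z.
Arguments assocI {k m} X Y Z.
Arguments lunit {k m} X.
Arguments lunitI {k m} X.
Arguments runit {k m} X.
Arguments runitI {k m} X.

Notation "X \ox Y" := (ten X Y) : cat_scope.
Notation "f \om g" := (tenm f g) : cat_scope.

Lemma ten0m (k : fieldType) (C : moncat k) (X X' Y Y' : C) (g : hom Y Y') :
  (0 : hom X X') \om g = 0.
Proof.
have := tenm_linl (-1) (0 : hom X X') 0 g.
by rewrite scaler0 addr0 scaleN1r addNr.
Qed.

Lemma assoc_runit (k : fieldType) (C : moncat k) (X Y : C) :
  (idm X \om runit Y) \oc assoc X Y (unit_obj C) = runit (X \ox Y).
Proof.
have faithful (Z W : C) (f g : hom Z W) :
    f \om idm (unit_obj C) = g \om idm (unit_obj C) -> f = g.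
  move=> H; rewrite -[f]compm1 -[g]compm1 -(runitIK Z) !compA.
  by rewrite -!runit_nat H.
apply: faithful; set I := unit_obj C.
have epi (Z W V : C) (e : hom Z W) (e' : hom W Z) (f g : hom W V) :
    e \oc e' = idm W -> f \oc e = g \oc e -> f = g.
  by move=> He H; rewrite -[f]compm1 -[g]compm1 -He !compA H.
have monic (Z W V : C) (e : hom W Z) (e' : hom Z W) (f g : hom V W) :
    e' \oc e = idm W -> e \oc f = e \oc g -> f = g.
  by move=> He H; rewrite -[f]comp1m -[g]comp1m -He -!compA H.
apply: (monic _ _ _ (assoc X Y I) (assocI X Y I)); first exact: assocK.
rewrite -triangle compA -tenm_id assoc_nat -compA pentagon.
rewrite !compA -tenm_comp comp1m triangle -assoc_nat -compA -tenm_comp.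
by rewrite comp1m.
Qed.

(* X is a left dual of Y (and Y a right dual of X); the two equations are the
   zigzag identities, with the inverse unitors moved to the other side. *)
Definition is_dual_pair (k : fieldType) (C : moncat k) (X Y : C) : Prop :=
  exists (ev : hom (X \ox Y) (unit_obj C)) (coev : hom (unit_obj C) (Y \ox X)),
    runit Y \oc (idm Y \om ev) \oc assoc Y X Y \oc (coev \om idm Y) = lunit Y /\
    lunit X \oc (ev \om idm X) \oc assocI X Y X \oc (idm X \om coev) = runit X.

Definition rigid (k : fieldType) (C : moncat k) : Prop :=
  forall X : C,
    (exists Xl : C, is_dual_pair Xl X) /\ (exists Xr : C, is_dual_pair X Xr).

Record braiding (k : fieldType) (C : moncat k) := Braiding {
  braid : forall X Y : C, hom (X \ox Y) (Y \ox X);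
  braid_iso : forall X Y, is_iso (braid X Y);
  braid_nat : forall (X X' Y Y' : C) (f : hom X X') (g : hom Y Y'),
    braid X' Y' \oc (f \om g) = (g \om f) \oc braid X Y;
  hexagon1 : forall X Y Z : C,
    assoc Y Z X \oc braid X (Y \ox Z) \oc assoc X Y Z =
    (idm Y \om braid X Z) \oc assoc Y X Z \oc (braid X Y \om idm Z);
  hexagon2 : forall X Y Z : C,
    assocI Z X Y \oc braid (X \ox Y) Z \oc assocI X Y Z =
    (braid X Z \om idm Y) \oc assocI X Z Y \oc (idm X \om braid Y Z) }.

Record is_fin_tensor (k : fieldType) (C : moncat k) : Prop := IsFinTensor {
  fin_tensor_finite : finite_abelian C;
  fin_tensor_rigid : rigid C;
  fin_tensor_simple1 : simple_obj (unit_obj C) }.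

Record braided_fin_tensor_cat (k : fieldType) := BraidedFinTensorCat {
  bft_cat :> moncat k;
  bft_braiding : braiding bft_cat;
  bft_fin_tensor : is_fin_tensor bft_cat }.

Record algebra (k : fieldType) (C : moncat k) := Algebra {
  alg_obj :> C;
  amul : hom (alg_obj \ox alg_obj) alg_obj;
  aunit : hom (unit_obj C) alg_obj;
  amulA : amul \oc (amul \om idm alg_obj) =
          amul \oc (idm alg_obj \om amul) \oc assoc alg_obj alg_obj alg_obj;
  amul1m : amul \oc (aunit \om idm alg_obj) = lunit alg_obj;
  amulm1 : amul \oc (idm alg_obj \om aunit) = runit alg_obj }.

Record rmodule (k : fieldType) (C : moncat k) (A : algebra C) := RModule {
  rm_obj :> C;
  ract : hom (rm_obj \ox A) rm_obj;
  ractA : ract \oc (ract \om idm A) =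
          ract \oc (idm rm_obj \om amul A) \oc assoc rm_obj A A;
  ract1 : ract \oc (idm rm_obj \om aunit A) = runit rm_obj }.

Definition rmhom_pred (k : fieldType) (C : moncat k) (A : algebra C)
    (M N : rmodule A) : pred (@hom k C M N) :=
  fun f => f \oc ract M == ract N \oc (f \om idm A).

Lemma rmhom_submod_closed (k : fieldType) (C : moncat k) (A : algebra C)
    (M N : rmodule A) :
  GRing.submod_closed (rmhom_pred (M := M) (N := N)).
Proof.
split=> [|c f g]; rewrite !unfold_in /rmhom_pred.
  by rewrite comp0m ten0m compm0.
move=> /eqP Hf /eqP Hg; apply/eqP.
by rewrite comp_linl tenm_linl comp_linr Hf Hg.
Qed.

HB.instance Definition _ (k : fieldType) (C : moncat k) (A : algebra C)
    (M N : rmodule A) :=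
  GRing.isSubmodClosed.Build k (@hom k C M N) (rmhom_pred (M := M) (N := N))
    (rmhom_submod_closed M N).

Record rmhom (k : fieldType) (C : moncat k) (A : algebra C)
    (M N : rmodule A) := RMHom {
  rmhom_val :> @hom k C M N;
  rmhom_valP : rmhom_val \in rmhom_pred (M := M) (N := N) }.

HB.instance Definition _ (k : fieldType) (C : moncat k) (A : algebra C)
    (M N : rmodule A) := [isSub for @rmhom_val k C A M N].
HB.instance Definition _ (k : fieldType) (C : moncat k) (A : algebra C)
    (M N : rmodule A) := [Choice of rmhom M N by <:].
HB.instance Definition _ (k : fieldType) (C : moncat k) (A : algebra C)
    (M N : rmodule A) := [SubChoice_isSubLmodule of rmhom M N by <:].

Lemma rmhom_idP (k : fieldType) (C : moncat k) (A : algebra C)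
    (M : rmodule A) :
  @idm k C M \in rmhom_pred (M := M) (N := M).
Proof.
by rewrite unfold_in /rmhom_pred comp1m tenm_id compm1.
Qed.

Lemma rmhom_compP (k : fieldType) (C : moncat k) (A : algebra C)
    (M N P : rmodule A) (g : rmhom N P) (f : rmhom M N) :
  rmhom_val g \oc rmhom_val f \in rmhom_pred (M := M) (N := P).
Proof.
have := rmhom_valP f; have := rmhom_valP g.
rewrite !unfold_in /rmhom_pred => /eqP Hg /eqP Hf; apply/eqP.
rewrite -{1}(comp1m (idm A)) tenm_comp -compA Hf compA Hg.
by rewrite compA.
Qed.

Definition rmod_cat (k : fieldType) (C : moncat k) (A : algebra C) : lincat k.
Proof.
refine {| obj := rmodule A;
          hom := fun M N => rmhom M N : lmodType k;
          idm := fun M => RMHom (rmhom_idP M);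
          comp := fun M N P (g : rmhom N P) (f : rmhom M N) =>
                    RMHom (rmhom_compP g f) |}.
- by move=> M N f; apply: val_inj; rewrite /= comp1m.
- by move=> M N f; apply: val_inj; rewrite /= compm1.
- by move=> M N P Q h g f; apply: val_inj; rewrite /= compA.
- by move=> M N P a g g' f; apply: val_inj; rewrite /= comp_linl.
- by move=> M N P a g f f'; apply: val_inj; rewrite /= comp_linr.
Defined.

Definition regular_rmodule (k : fieldType) (C : moncat k) (A : algebra C) :
    rmodule A :=
  {| rm_obj := A; ract := amul A; ractA := amulA A; ract1 := amulm1 A |}.

Section LeftAction.
Context (k : fieldType) (C : moncat k) (A : algebra C).

Definition lact_ract (X : C) (M : rmodule A) : hom (X \ox M \ox A) (X \ox M) :=
  (idm X \om ract M) \oc assoc X M A.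

Lemma lact_ractA (X : C) (M : rmodule A) :
  lact_ract X M \oc (lact_ract X M \om idm A) =
  lact_ract X M \oc (idm (X \ox M) \om amul A) \oc assoc (X \ox M) A A.
Proof.
rewrite /lact_ract -{1}(comp1m (idm A)) tenm_comp.
rewrite -!compA -tenm_id [assoc X M A \oc (_ \oc assoc _ _ _)]compA assoc_nat.
rewrite -!compA pentagon !compA -tenm_comp comp1m -[in LHS](compA _ (assoc X M A)).
rewrite assoc_nat !compA -!tenm_comp !comp1m.
by rewrite ractA.
Qed.

Lemma lact_ract1 (X : C) (M : rmodule A) :
  lact_ract X M \oc (idm (X \ox M) \om aunit A) = runit (X \ox M).
Proof.
rewrite /lact_ract -tenm_id -compA assoc_nat compA -tenm_comp comp1m ract1.
exact: assoc_runit.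
Qed.

Definition lact (X : C) (M : rmodule A) : rmodule A :=
  {| rm_obj := X \ox M; ract := lact_ract X M;
     ractA := lact_ractA X M; ract1 := lact_ract1 X M |}.

Lemma lact_homP (X X' : C) (M M' : rmodule A) (x : hom X X') (f : rmhom M M') :
  x \om rmhom_val f \in rmhom_pred (M := lact X M) (N := lact X' M').
Proof.
rewrite unfold_in /rmhom_pred /= /lact_ract; apply/eqP.
have := rmhom_valP f; rewrite unfold_in /rmhom_pred => /eqP Hf.
by rewrite -compA assoc_nat !compA -!tenm_comp compm1 comp1m Hf.
Qed.

Definition lact_hom (X X' : C) (M M' : rmod_cat A) (x : hom X X')
    (f : hom M M') : hom (lact X M : rmod_cat A) (lact X' M') :=
  RMHom (lact_homP x f).

End LeftAction.

(* The functor (C_A)^op x C_A -> C together with the bijections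
   Hom_{C_A}(X (x) M, N) ~ Hom_C(X, ihom M N), natural in X, M and N.
   These data are unique up to a unique isomorphism. *)
Record internal_hom (k : fieldType) (C : moncat k) (A : algebra C) :=
    InternalHom {
  ihom : rmod_cat A -> rmod_cat A -> C;
  ihom_map : forall M M' N N' : rmod_cat A,
    hom M' M -> hom N N' -> hom (ihom M N) (ihom M' N');
  ihom_id : forall M N : rmod_cat A,
    ihom_map (idm M) (idm N) = idm (ihom M N);
  ihom_comp : forall (M M' M'' N N' N'' : rmod_cat A)
      (f : hom M' M) (f' : hom M'' M') (g : hom N N') (g' : hom N' N''),
    ihom_map (f \oc f') (g' \oc g) = ihom_map f' g' \oc ihom_map f g;
  ihom_adj : forall (X : C) (M N : rmod_cat A),
    hom (lact X M : rmod_cat A) N -> hom X (ihom M N);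
  ihom_adj_bij : forall (X : C) (M N : rmod_cat A),
    bijective (@ihom_adj X M N);
  ihom_adj_nat : forall (X X' : C) (M M' N N' : rmod_cat A)
      (x : hom X' X) (f : hom M' M) (g : hom N N')
      (h : hom (lact X M : rmod_cat A) N),
    ihom_adj (g \oc h \oc lact_hom x f) =
    ihom_map f g \oc ihom_adj h \oc x }.

Lemma ihom_to_id (k : fieldType) (C : moncat k) (A : algebra C)
    (H : internal_hom A) (N : rmod_cat A) (M : op (rmod_cat A)) :
  ihom_map H (idm M) (idm N) = idm (ihom H M N).
Proof. exact: ihom_id. Qed.

Lemma ihom_to_comp (k : fieldType) (C : moncat k) (A : algebra C)
    (H : internal_hom A) (N : rmod_cat A) (M M' M'' : op (rmod_cat A))
    (g : hom M' M'') (f : hom M M') :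
  ihom_map H (g \oc f) (idm N) =
  ihom_map H g (idm N) \oc ihom_map H f (idm N).
Proof. by rewrite -ihom_comp comp1m. Qed.

Definition ihom_to (k : fieldType) (C : moncat k) (A : algebra C)
    (H : internal_hom A) (N : rmod_cat A) : functor (op (rmod_cat A)) C :=
  {| fobj := fun M : op (rmod_cat A) => ihom H M N;
     fmap := fun (M M' : op (rmod_cat A)) (f : hom M M') =>
               ihom_map H f (idm N);
     fmap_id := ihom_to_id H N;
     fmap_comp := @ihom_to_comp k C A H N |}.

Definition C_injective (k : fieldType) (C : moncat k) (A : algebra C)
    (M : rmod_cat A) : Prop :=
  exists H : internal_hom A, exact_functor (ihom_to H M).

Definition quasi_frobenius (k : fieldType) (C : moncat k) (A : algebra C) :
    Prop :=
  C_injective (regular_rmodule A : rmod_cat A).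

Definition middle_swap (k : fieldType) (C : moncat k) (c : braiding C)
    (W X Y Z : C) : hom ((W \ox X) \ox (Y \ox Z)) ((W \ox Y) \ox (X \ox Z)) :=
  assocI W Y (X \ox Z)
  \oc (idm W \om (assoc Y X Z \oc (braid c X Y \om idm Z) \oc assocI X Y Z))
  \oc assoc W X (Y \ox Z).

Record hopf_algebra (k : fieldType) (C : moncat k) (c : braiding C) :=
    HopfAlgebra {
  hopf_alg :> algebra C;
  comul : hom hopf_alg (hopf_alg \ox hopf_alg);
  counit : hom hopf_alg (unit_obj C);
  comulA : (idm hopf_alg \om comul) \oc comul =
           assoc hopf_alg hopf_alg hopf_alg \oc (comul \om idm hopf_alg)
             \oc comul;
  counitl : lunit hopf_alg \oc (counit \om idm hopf_alg) \oc comul =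
            idm hopf_alg;
  counitr : runit hopf_alg \oc (idm hopf_alg \om counit) \oc comul =
            idm hopf_alg;
  comul_mul : comul \oc amul hopf_alg =
              (amul hopf_alg \om amul hopf_alg)
                \oc middle_swap c hopf_alg hopf_alg hopf_alg hopf_alg
                \oc (comul \om comul);
  comul_unit : comul \oc aunit hopf_alg =
               (aunit hopf_alg \om aunit hopf_alg) \oc lunitI (unit_obj C);
  counit_mul : counit \oc amul hopf_alg =
               lunit (unit_obj C) \oc (counit \om counit);
  counit_unit : counit \oc aunit hopf_alg = idm (unit_obj C);
  antipode : hom hopf_alg hopf_alg;
  antipodel : amul hopf_alg \oc (antipode \om idm hopf_alg) \oc comul =
              aunit hopf_alg \oc counit;
  antipoder : amul hopf_alg \oc (idm hopf_alg \om antipode) \oc comul =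
              aunit hopf_alg \oc counit }.

(* Main.v *)
From mathcomp Require Import all_boot all_algebra all_field.
From mathcomp Require Import boolp.
Require Import Defs.

(** Let [H] be a Hopf algebra and [D] the left dual of its underlying object.  For
    a right [H]-module [Y] and a morphism [phi : Y -> H] of C put, in Sweedler
    notation and with the braided partial trace over [x] in [H],
      r(phi)(y) = tr_x (x |-> S(h_1) (x) h_2),   h = phi(y x_1) S(x_2).
    The identities S(a_1 x) a_2 = eps(a) S(x) and a_1 S(h a_2) = S(h) eps(a)
    show that [r(phi)] is [H]-linear, and [r(phi) = phi] if [phi] already is.
    As [r] is natural in [Y], the functor Hom_H(-, H) is a natural retract of
    [M |-> H (x) M^*], the internal Hom of C restricted along the forgetful
    functor.  The latter functor turns kernels into cokernels because [M |-> M^*]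
    does so in C and the forgetful functor has a left adjoint; a retract of a
    cokernel diagram is again one.  That Hom_H(-, H) turns cokernels into kernels
    holds for every internal Hom, since X (x) - has a right adjoint on modules. *)

Set Implicit Arguments.
Unset Strict Implicit.
Unset Printing Implicit Defensive.

Import GRing.Theory.
Local Open Scope ring_scope.
Local Open Scope cat_scope.

Reserved Notation "X \lw f" (at level 40, left associativity).
Notation "X \lw f" := (idm X \om f) : cat_scope.

(** For a finite-dimensional Hopf algebra over a field, self-injectivity is usually derived from a
    nonzero integral, obtained from the structure theorem for Hopf modules. The operator r replaces
    the integral by a trace over [H], available from the dual alone. Write h(y, x) = phi(y x_1)
    S(x_2). Linearity of r(phi) is cyclicity of the trace: in S(h_1) (x) h_2 a = a_1 S(h_1 a_2) (x)
    h_2 a_3 the factor a_1 moves around the trace and turns x into a_1 x, and h(y, a_1 x) a_2 = h(y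
    a, x) absorbs it. The normalisation needs no division by a dimension: for linear phi one has
    h(y, x) = phi(y) eps(x), so the traced map has rank one in x and its trace is eps(S(h_1)) h_2 =
    phi(y) for h = phi(y), in any characteristic. The finite abelian structure enters through
    kernels: [C_injective] asks for an internal Hom, and that object is cut out as a kernel. *)

Section Composition.
Context (k : fieldType) (C : lincat k).

(** Composites are kept nested to the right, so an identity between composites applies in the middle
    of a longer one only after a further factor [x] has been appended. This lemma and its longer
    versions do that. *)
Lemma comp_ext (X0 X1 X2 : C) (f0 : hom X1 X0) (f1 : hom X2 X1) (h : hom X2 X0) :
  f0 \oc f1 = h -> forall W (x : hom W X2), f0 \oc (f1 \oc x) = h \oc x.
Proof. by move=> <- W x; rewrite !compA. Qed.

Lemma comp_ext3 (X0 X1 X2 X3 : C)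
    (f0 : hom X1 X0) (f1 : hom X2 X1) (f2 : hom X3 X2)
    (h : hom X3 X0) :
  f0 \oc (f1 \oc f2) = h ->
  forall W (x : hom W X3), f0 \oc (f1 \oc (f2 \oc x)) = h \oc x.
Proof. by move=> <- W x; rewrite !compA. Qed.

Lemma comp_ext4 (X0 X1 X2 X3 X4 : C)
    (f0 : hom X1 X0) (f1 : hom X2 X1) (f2 : hom X3 X2)
    (f3 : hom X4 X3) (h : hom X4 X0) :
  f0 \oc (f1 \oc (f2 \oc f3)) = h ->
  forall W (x : hom W X4), f0 \oc (f1 \oc (f2 \oc (f3 \oc x))) = h \oc x.
Proof. by move=> <- W x; rewrite !compA. Qed.

Lemma comp_ext5 (X0 X1 X2 X3 X4 X5 : C)
    (f0 : hom X1 X0) (f1 : hom X2 X1) (f2 : hom X3 X2)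
    (f3 : hom X4 X3) (f4 : hom X5 X4) (h : hom X5 X0) :
  f0 \oc (f1 \oc (f2 \oc (f3 \oc f4))) = h ->
  forall W (x : hom W X5), f0 \oc (f1 \oc (f2 \oc (f3 \oc (f4 \oc x)))) = h \oc x.
Proof. by move=> <- W x; rewrite !compA. Qed.

Lemma comp_ext6 (X0 X1 X2 X3 X4 X5 X6 : C)
    (f0 : hom X1 X0) (f1 : hom X2 X1) (f2 : hom X3 X2)
    (f3 : hom X4 X3) (f4 : hom X5 X4) (f5 : hom X6 X5) (h : hom X6 X0) :
  f0 \oc (f1 \oc (f2 \oc (f3 \oc (f4 \oc f5)))) = h ->
  forall W (x : hom W X6), f0 \oc (f1 \oc (f2 \oc (f3 \oc (f4 \oc (f5 \oc x))))) = h \oc x.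
Proof. by move=> <- W x; rewrite !compA. Qed.

Lemma split_epi_cancel (X Y Z : C) (e : hom X Y) (s : hom Y X) (f g : hom Y Z) :
  e \oc s = idm Y -> f \oc e = g \oc e -> f = g.
Proof. by move=> es fe; rewrite -[f]compm1 -[g]compm1 -es !compA fe. Qed.

Lemma split_mono_cancel (X Y Z : C) (i : hom Y X) (s : hom X Y) (f g : hom Z Y) :
  s \oc i = idm Y -> i \oc f = i \oc g -> f = g.
Proof. by move=> si fe; rewrite -[f]comp1m -[g]comp1m -si -!compA fe. Qed.

End Composition.

(** * Coherence *)

Section Coherence.
Context (k : fieldType) (C : moncat k).
Implicit Types X Y Z W U T : C.
Notation I := (unit_obj C).

Lemma lw_comp X Y Z W (g : hom Z W) (f : hom Y Z) :
  X \lw (g \oc f) = (X \lw g) \oc (X \lw f).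
Proof. by rewrite -tenm_comp comp1m. Qed.

Lemma rw_comp X Y Z W (g : hom Z W) (f : hom Y Z) :
  (g \oc f) \om idm X = (g \om idm X) \oc (f \om idm X).
Proof. by rewrite -tenm_comp comp1m. Qed.

Lemma lw_eq X Y Z W (g : hom Z W) (f : hom Y Z) h :
  g \oc f = h -> (X \lw g) \oc (X \lw f) = X \lw h.
Proof. by move=> <-; rewrite lw_comp. Qed.

Lemma lw_eq3 X (X0 X1 X2 X3 : C) (f0 : hom X1 X0) (f1 : hom X2 X1) (f2 : hom X3 X2) h :
  f0 \oc (f1 \oc f2) = h ->
  (X \lw f0) \oc ((X \lw f1) \oc (X \lw f2)) = X \lw h.
Proof. by move=> <-; rewrite !lw_comp. Qed.

Lemma lw_eq5 X (X0 X1 X2 X3 X4 X5 : C)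
    (f0 : hom X1 X0) (f1 : hom X2 X1) (f2 : hom X3 X2)
    (f3 : hom X4 X3) (f4 : hom X5 X4) h :
  f0 \oc (f1 \oc (f2 \oc (f3 \oc f4))) = h ->
  (X \lw f0) \oc ((X \lw f1) \oc ((X \lw f2) \oc ((X \lw f3) \oc (X \lw f4)))) = X \lw h.
Proof. by move=> <-; rewrite !lw_comp. Qed.

Lemma lw_eq6 X (X0 X1 X2 X3 X4 X5 X6 : C)
    (f0 : hom X1 X0) (f1 : hom X2 X1) (f2 : hom X3 X2)
    (f3 : hom X4 X3) (f4 : hom X5 X4) (f5 : hom X6 X5) h :
  f0 \oc (f1 \oc (f2 \oc (f3 \oc (f4 \oc f5)))) = h ->
  (X \lw f0) \oc ((X \lw f1) \oc ((X \lw f2) \oc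
    ((X \lw f3) \oc ((X \lw f4) \oc (X \lw f5))))) = X \lw h.
Proof. by move=> <-; rewrite !lw_comp. Qed.

Lemma rw_eq X Y Z W (g : hom Z W) (f : hom Y Z) h :
  g \oc f = h -> (g \om idm X) \oc (f \om idm X) = h \om idm X.
Proof. by move=> <-; rewrite rw_comp. Qed.

Lemma interchange X X' Y Y' (f : hom X X') (g : hom Y Y') :
  (f \om idm Y') \oc (X \lw g) = (X' \lw g) \oc (f \om idm Y).
Proof. by rewrite -!tenm_comp !comp1m !compm1. Qed.

Lemma tenm_lr X X' Y Y' (f : hom X X') (g : hom Y Y') :
  f \om g = (f \om idm Y') \oc (X \lw g).
Proof. by rewrite -tenm_comp comp1m compm1. Qed.

Lemma assocI_nat X X' Y Y' Z Z' (f : hom X X') (g : hom Y Y') (h : hom Z Z') :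
  assocI X' Y' Z' \oc (f \om (g \om h)) = ((f \om g) \om h) \oc assocI X Y Z.
Proof.
apply: (split_epi_cancel (assocIK X Y Z)).
by rewrite -!compA assocK compm1 -assoc_nat compA assocK comp1m.
Qed.

Lemma assoc_rw X X' Y Z (f : hom X X') :
  assoc X' Y Z \oc ((f \om idm Y) \om idm Z) = (f \om idm (Y \ox Z)) \oc assoc X Y Z.
Proof. by rewrite assoc_nat tenm_id. Qed.

Lemma assoc_lw X Y Z Z' (h : hom Z Z') :
  assoc X Y Z' \oc ((X \ox Y) \lw h) = (X \lw (Y \lw h)) \oc assoc X Y Z.
Proof. by rewrite -tenm_id assoc_nat. Qed.

Lemma assocI_rw X X' Y Z (f : hom X X') :
  assocI X' Y Z \oc (f \om idm (Y \ox Z)) = ((f \om idm Y) \om idm Z) \oc assocI X Y Z.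
Proof. by rewrite -assocI_nat tenm_id. Qed.

Lemma assocI_lw X Y Z Z' (h : hom Z Z') :
  assocI X Y Z' \oc (X \lw (Y \lw h)) = ((X \ox Y) \lw h) \oc assocI X Y Z.
Proof. by rewrite assocI_nat tenm_id. Qed.

Lemma lunitI_nat X Y (f : hom X Y) : (I \lw f) \oc lunitI X = lunitI Y \oc f.
Proof.
apply: (split_epi_cancel (lunitIK X)).
by rewrite -!compA lunitK compm1 -lunit_nat compA lunitK comp1m.
Qed.

Lemma runitI_nat X Y (f : hom X Y) : (f \om idm I) \oc runitI X = runitI Y \oc f.
Proof.
apply: (split_epi_cancel (runitIK X)).
by rewrite -!compA runitK compm1 -runit_nat compA runitK comp1m.
Qed.

Lemma rw_unit_inj X Y (f g : hom X Y) : f \om idm I = g \om idm I -> f = g.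
Proof.
by move=> fg; rewrite -[f]compm1 -[g]compm1 -(runitIK X) !compA -!runit_nat fg.
Qed.

Lemma lw_unit_inj X Y (f g : hom X Y) : I \lw f = I \lw g -> f = g.
Proof.
by move=> fg; rewrite -[f]compm1 -[g]compm1 -(lunitIK X) !compA -!lunit_nat fg.
Qed.

Lemma pentagonI W X Y Z :
  assocI (W \ox X) Y Z \oc assocI W X (Y \ox Z) =
  (assocI W X Y \om idm Z) \oc assocI W (X \ox Y) Z \oc (W \lw assocI X Y Z).
Proof.
apply: (split_epi_cancel (assocIK W X (Y \ox Z))).
apply: (split_epi_cancel (assocIK (W \ox X) Y Z)).
rewrite -!compA (compA (assocI _ _ _) (assoc W X (Y \ox Z))) assocK comp1m assocK.
rewrite pentagon -!compA (comp_ext (lw_eq W (assocK X Y Z))) tenm_id comp1m.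
by rewrite (comp_ext (assocK _ _ _)) comp1m (rw_eq _ (assocK _ _ _)) tenm_id.
Qed.

Lemma pentagon' W X Y Z :
  assocI (W \ox X) Y Z \oc (assocI W X (Y \ox Z) \oc (W \lw assoc X Y Z)) =
  (assocI W X Y \om idm Z) \oc assocI W (X \ox Y) Z.
Proof.
rewrite (comp_ext (pentagonI _ _ _ _)) -!compA.
by rewrite (lw_eq _ (assocK _ _ _)) tenm_id compm1.
Qed.

(** Kelly's argument: tensoring with [I] on the left is faithful, and after precomposition with
    invertible associators the claim follows from the pentagon and two instances of the triangle. *)
Lemma lunit_assoc X Y :
  lunit (X \ox Y) \oc assoc I X Y = lunit X \om idm Y.
Proof.
apply: lw_unit_inj; rewrite lw_comp.
apply: (split_epi_cancel (assocIK _ _ _)).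
rewrite -assoc_nat.
apply: (split_epi_cancel (e := assoc I I X \om idm Y)
          (s := assocI I I X \om idm Y)).
  by rewrite (rw_eq _ (assocIK _ _ _)) tenm_id.
rewrite -!compA.
have -> : (I \lw assoc I X Y) \oc (assoc I (I \ox X) Y \oc (assoc I I X \om idm Y))
  = assoc I I (X \ox Y) \oc assoc (I \ox I) X Y by rewrite pentagon compA.
by rewrite (comp_ext (triangle _ _)) -assoc_rw (rw_eq _ (triangle _ _)).
Qed.

Lemma runit_unit : runit I = lunit I.
Proof.
apply: rw_unit_inj.
rewrite -triangle -lunit_assoc; congr (_ \oc _).
apply: (split_mono_cancel (lunitK I)).
by rewrite lunit_nat.
Qed.

Lemma triangle_lunitI X T :
  assoc X I T \oc (runitI X \om idm T) = X \lw lunitI T.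
Proof.
apply: (split_mono_cancel (i := X \lw lunit T) (s := X \lw lunitI T)).
  by rewrite -lw_comp lunitK tenm_id.
by rewrite (comp_ext (triangle _ _)) -rw_comp -lw_comp runitIK lunitIK !tenm_id.
Qed.

Lemma triangleI X T :
  assocI X I T \oc (X \lw lunitI T) = runitI X \om idm T.
Proof. by rewrite -triangle_lunitI (comp_ext (assocK _ _ _)) comp1m. Qed.

Lemma lunitI_assoc X Y :
  assoc I X Y \oc (lunitI X \om idm Y) = lunitI (X \ox Y).
Proof.
apply: (split_mono_cancel (lunitK (X \ox Y))).
by rewrite (comp_ext (lunit_assoc _ _)) -rw_comp !lunitIK tenm_id.
Qed.

Lemma lunit_assocI X Y :
  (lunit X \om idm Y) \oc assocI I X Y = lunit (X \ox Y).
Proof. by rewrite -lunit_assoc -compA assocIK compm1. Qed.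

Lemma runit_assocI X Y :
  (runit X \om idm Y) \oc assocI X I Y = X \lw lunit Y.
Proof. by rewrite -triangle -compA assocIK compm1. Qed.

Lemma tenm_rl X X' Y Y' (f : hom X X') (g : hom Y Y') :
  f \om g = (X' \lw g) \oc (f \om idm Y).
Proof. by rewrite -tenm_comp comp1m compm1. Qed.

End Coherence.

(** * Lifting morphisms to right-nested products with a tail *)

Section Lifts.
Context (k : fieldType) (C : moncat k).
Implicit Types X Y Z W U T : C.
Notation I := (unit_obj C).

(** The variants [pentagonA] to [pentagonF] are the pentagon with some edges inverted, each oriented
    for one rewriting situation. *)
Lemma pentagonA W X Y Z :
  (W \lw assocI X Y Z) \oc (assoc W X (Y \ox Z) \oc assoc (W \ox X) Y Z) =
  assoc W (X \ox Y) Z \oc (assoc W X Y \om idm Z).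
Proof.
by rewrite pentagon -!compA (comp_ext (lw_eq _ (assocK _ _ _))) tenm_id comp1m.
Qed.

Lemma pentagonB W X Y Z :
  assoc (W \ox X) Y Z \oc ((assocI W X Y \om idm Z) \oc assocI W (X \ox Y) Z) =
  assocI W X (Y \ox Z) \oc (W \lw assoc X Y Z).
Proof. by rewrite -pentagon' (comp_ext (assocIK _ _ _)) comp1m. Qed.

Lemma pentagonC W X Y Z :
  assocI W (X \ox Y) Z \oc (W \lw assocI X Y Z) =
  (assoc W X Y \om idm Z) \oc (assocI (W \ox X) Y Z \oc assocI W X (Y \ox Z)).
Proof.
by rewrite pentagonI -!compA (comp_ext (rw_eq _ (assocIK _ _ _))) tenm_id comp1m.
Qed.

Lemma pentagonD W X Y Z :
  assoc W X (Y \ox Z) \oc (assoc (W \ox X) Y Z \oc (assocI W X Y \om idm Z)) =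
  (W \lw assoc X Y Z) \oc assoc W (X \ox Y) Z.
Proof.
by rewrite (comp_ext (pentagon _ _ _ _)) -!compA (rw_eq _ (assocIK _ _ _)) tenm_id compm1.
Qed.

(* Associators are avoided by working with families of morphisms natural in a
   "tail" [T] of right-nested products: [opmn f T] applies
   [f : X_1 ... X_m -> Y_1 ... Y_n] to the leading factors of X_1 (...(X_m T)).
   The definitions are locked because unification would otherwise see through
   them whenever one rewrites with associativity of the composition. *)
Definition op21 X Y Z (f : hom (X \ox Y) Z) T : hom (X \ox (Y \ox T)) (Z \ox T) :=
  locked ((f \om idm T) \oc assocI X Y T).
Definition op12 X Y Z (f : hom Z (X \ox Y)) T : hom (Z \ox T) (X \ox (Y \ox T)) :=
  locked (assoc X Y T \oc (f \om idm T)).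
Definition op22 X Y Z W (f : hom (X \ox Y) (Z \ox W)) T :
    hom (X \ox (Y \ox T)) (Z \ox (W \ox T)) :=
  locked (assoc Z W T \oc ((f \om idm T) \oc assocI X Y T)).
Definition op10 X (f : hom X I) T : hom (X \ox T) T :=
  locked (lunit T \oc (f \om idm T)).
Definition op01 X (f : hom I X) T : hom T (X \ox T) :=
  locked ((f \om idm T) \oc lunitI T).
Definition op20 X Y (f : hom (X \ox Y) I) T : hom (X \ox (Y \ox T)) T :=
  locked (lunit T \oc ((f \om idm T) \oc assocI X Y T)).
Definition op02 X Y (f : hom I (X \ox Y)) T : hom T (X \ox (Y \ox T)) :=
  locked (assoc X Y T \oc ((f \om idm T) \oc lunitI T)).

Lemma op21E X Y Z (f : hom (X \ox Y) Z) T : op21 f T = (f \om idm T) \oc assocI X Y T.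
Proof. by rewrite /op21 -lock. Qed.
Lemma op12E X Y Z (f : hom Z (X \ox Y)) T : op12 f T = assoc X Y T \oc (f \om idm T).
Proof. by rewrite /op12 -lock. Qed.
Lemma op22E X Y Z W (f : hom (X \ox Y) (Z \ox W)) T :
  op22 f T = assoc Z W T \oc ((f \om idm T) \oc assocI X Y T).
Proof. by rewrite /op22 -lock. Qed.
Lemma op10E X (f : hom X I) T : op10 f T = lunit T \oc (f \om idm T).
Proof. by rewrite /op10 -lock. Qed.
Lemma op01E X (f : hom I X) T : op01 f T = (f \om idm T) \oc lunitI T.
Proof. by rewrite /op01 -lock. Qed.
Lemma op20E X Y (f : hom (X \ox Y) I) T :
  op20 f T = lunit T \oc ((f \om idm T) \oc assocI X Y T).
Proof. by rewrite /op20 -lock. Qed.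
Lemma op02E X Y (f : hom I (X \ox Y)) T :
  op02 f T = assoc X Y T \oc ((f \om idm T) \oc lunitI T).
Proof. by rewrite /op02 -lock. Qed.

Lemma op21_nat X Y Z (f : hom (X \ox Y) Z) T T' (t : hom T T') :
  op21 f T' \oc (X \lw (Y \lw t)) = (Z \lw t) \oc op21 f T.
Proof. by rewrite !op21E -!compA assocI_lw !compA interchange. Qed.

Lemma op12_nat X Y Z (f : hom Z (X \ox Y)) T T' (t : hom T T') :
  op12 f T' \oc (Z \lw t) = (X \lw (Y \lw t)) \oc op12 f T.
Proof. by rewrite !op12E -!compA interchange !compA assoc_lw. Qed.

Lemma op22_nat X Y Z W (f : hom (X \ox Y) (Z \ox W)) T T' (t : hom T T') :
  op22 f T' \oc (X \lw (Y \lw t)) = (Z \lw (W \lw t)) \oc op22 f T.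
Proof.
by rewrite !op22E -!compA assocI_lw (comp_ext (interchange _ _)) !compA assoc_lw.
Qed.

Lemma op10_nat X (f : hom X I) T T' (t : hom T T') :
  op10 f T' \oc (X \lw t) = t \oc op10 f T.
Proof. by rewrite !op10E -!compA interchange !compA lunit_nat. Qed.

Lemma op01_nat X (f : hom I X) T T' (t : hom T T') :
  op01 f T' \oc t = (X \lw t) \oc op01 f T.
Proof. by rewrite !op01E -!compA -lunitI_nat !compA interchange. Qed.

Lemma op20_nat X Y (f : hom (X \ox Y) I) T T' (t : hom T T') :
  op20 f T' \oc (X \lw (Y \lw t)) = t \oc op20 f T.
Proof.
by rewrite !op20E -!compA assocI_lw (comp_ext (interchange _ _)) !compA lunit_nat.
Qed.

Lemma op02_nat X Y (f : hom I (X \ox Y)) T T' (t : hom T T') :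
  op02 f T' \oc t = (X \lw (Y \lw t)) \oc op02 f T.
Proof.
by rewrite !op02E -!compA -lunitI_nat (comp_ext (interchange _ _)) !compA assoc_lw.
Qed.

Lemma op21_l X X' Y Z (f : hom (X' \ox Y) Z) (g : hom X X') T :
  op21 f T \oc (g \om idm (Y \ox T)) = op21 (f \oc (g \om idm Y)) T.
Proof. by rewrite !op21E -!compA assocI_rw rw_comp !compA. Qed.

Lemma op12_l X X' Y Z (f : hom Z (X \ox Y)) (g : hom X X') T :
  (g \om idm (Y \ox T)) \oc op12 f T = op12 ((g \om idm Y) \oc f) T.
Proof. by rewrite !op12E compA -assoc_rw rw_comp !compA. Qed.

Lemma op12_r X Y Y' Z (f : hom Z (X \ox Y)) (g : hom Y Y') T :
  (X \lw (g \om idm T)) \oc op12 f T = op12 ((X \lw g) \oc f) T.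
Proof. by rewrite !op12E compA -assoc_nat rw_comp !compA. Qed.

Lemma op21_op12 X Y Z W (f : hom (X \ox Y) W) (g : hom Z (X \ox Y)) T :
  op21 f T \oc op12 g T = (f \oc g) \om idm T.
Proof. by rewrite !op21E !op12E -!compA (comp_ext (assocK _ _ _)) comp1m rw_comp. Qed.

Lemma op12_op21 X Y Z U V (f : hom (X \ox Y) Z) (g : hom Z (U \ox V)) T :
  op12 g T \oc op21 f T = op22 (g \oc f) T.
Proof. by rewrite !op21E !op12E !op22E rw_comp -!compA. Qed.

Lemma op01_op10 X Y (f : hom X I) (g : hom I Y) T :
  op01 g T \oc op10 f T = (g \oc f) \om idm T.
Proof. by rewrite !op01E !op10E -!compA (comp_ext (lunitK _)) comp1m rw_comp. Qed.

Lemma op10_op01 X (f : hom X I) (g : hom I X) T :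
  f \oc g = idm I -> op10 f T \oc op01 g T = idm T.
Proof.
move=> fg; rewrite !op01E !op10E -!compA (comp_ext (rw_eq _ fg)) tenm_id comp1m.
exact: lunitIK.
Qed.

Lemma op10_op21 X Y Z (f : hom Z I) (g : hom (X \ox Y) Z) T :
  op10 f T \oc op21 g T = op20 (f \oc g) T.
Proof. by rewrite !op10E !op21E !op20E -!compA rw_comp !compA. Qed.

(** In tail form the associator of an associativity law disappears. The same lemma serves the
    multiplication of an algebra and the action on a module. *)
Lemma op21_assoc X Y Z U V W (f : hom (U \ox Z) W) (g : hom (X \ox Y) U)
    (f' : hom (X \ox V) W) (g' : hom (Y \ox Z) V) T :
  f \oc (g \om idm Z) = f' \oc (X \lw g') \oc assoc X Y Z ->
  op21 f T \oc op21 g (Z \ox T) = op21 f' T \oc (X \lw op21 g' T).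
Proof.
move=> E; rewrite !op21E -!compA (comp_ext (assocI_rw _ _ _)) -!compA.
rewrite (comp_ext (rw_eq _ E)) !rw_comp -!compA -pentagonC lw_comp.
by rewrite (comp_ext (assocI_nat _ _ _)) -!compA.
Qed.

Lemma op12_assoc X Y Z U V W (f : hom W (U \ox Z)) (g : hom U (X \ox Y))
    (f' : hom W (X \ox V)) (g' : hom V (Y \ox Z)) T :
  (X \lw g') \oc f' = assoc X Y Z \oc (g \om idm Z) \oc f ->
  (X \lw op12 g' T) \oc op12 f' T = op12 g (Z \ox T) \oc op12 f T.
Proof.
move=> E; rewrite !op12E lw_comp -!compA (comp_ext (esym (assoc_nat _ _ _))) -!compA.
rewrite (rw_eq _ E) !rw_comp -!compA (comp_ext (esym (assoc_rw _ _ _))) -!compA.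
by rewrite (comp_ext (pentagon _ _ _ _)) -!compA.
Qed.

Lemma op10_op12 X Z (f : hom Z (X \ox Z)) (e : hom X I) T :
  lunit Z \oc (e \om idm Z) \oc f = idm Z -> op10 e (Z \ox T) \oc op12 f T = idm (Z \ox T).
Proof.
move=> E; rewrite !op10E !op12E -!compA (comp_ext (esym (assoc_rw _ _ _))) -!compA.
by rewrite (comp_ext (lunit_assoc _ _)) !(comp_ext (rw_eq _ erefl)) -rw_comp E tenm_id.
Qed.

Lemma op10_op12r X Z (f : hom Z (Z \ox X)) (e : hom X I) T :
  runit Z \oc (Z \lw e) \oc f = idm Z -> (Z \lw op10 e T) \oc op12 f T = idm (Z \ox T).
Proof.
move=> E; rewrite !op10E !op12E lw_comp -!compA (comp_ext (esym (assoc_nat _ _ _))) -!compA.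
by rewrite (comp_ext (triangle _ _)) !(comp_ext (rw_eq _ erefl)) -rw_comp E tenm_id.
Qed.

Lemma op21_op01 X Z (f : hom (X \ox Z) Z) (e : hom I X) T :
  f \oc (e \om idm Z) = lunit Z -> op21 f T \oc op01 e (Z \ox T) = idm (Z \ox T).
Proof.
move=> E; rewrite !op21E !op01E -!compA (comp_ext (assocI_rw _ _ _)) -!compA.
by rewrite (comp_ext (rw_eq _ E)) (comp_ext (lunit_assocI _ _)) lunitIK.
Qed.

Lemma op21_op01r X Z (f : hom (Z \ox X) Z) (e : hom I X) T :
  f \oc (Z \lw e) = runit Z -> op21 f T \oc (Z \lw op01 e T) = idm (Z \ox T).
Proof.
move=> E; rewrite !op21E !op01E lw_comp -!compA (comp_ext (assocI_nat _ _ _)) -!compA.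
by rewrite (comp_ext (rw_eq _ E)) triangleI -rw_comp runitIK tenm_id.
Qed.

Lemma zigzag_right X Y (ev : hom (X \ox Y) I) (coev : hom I (Y \ox X)) T :
  runit Y \oc (idm Y \om ev) \oc assoc Y X Y \oc (coev \om idm Y) = lunit Y ->
  (Y \lw op20 ev T) \oc op02 coev (Y \ox T) = idm (Y \ox T).
Proof.
move=> E; rewrite !op20E !op02E !lw_comp -!compA.
rewrite -(lunitI_assoc Y T) (comp_ext (esym (assoc_rw _ _ _))) -!compA.
rewrite (comp_ext3 (pentagonA _ _ _ _)) -!compA (comp_ext (esym (assoc_nat _ _ _))) -!compA.
rewrite (comp_ext (triangle _ _)) -!rw_comp !compA E lunitIK tenm_id //.
Qed.

Lemma zigzag_left X Y (ev : hom (X \ox Y) I) (coev : hom I (Y \ox X)) T :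
  lunit X \oc (ev \om idm X) \oc assocI X Y X \oc (idm X \om coev) = runit X ->
  op20 ev (X \ox T) \oc (X \lw op02 coev T) = idm (X \ox T).
Proof.
move=> E; rewrite !op20E !op02E !lw_comp -!compA.
rewrite (comp_ext (esym (pentagonB _ _ _ _))) -!compA.
rewrite (comp_ext (assocI_nat _ _ _)) -!compA triangleI.
rewrite (comp_ext (esym (assoc_rw _ _ _))) -!compA (comp_ext (lunit_assoc _ _)).
by rewrite -!rw_comp !compA E runitIK tenm_id.
Qed.

Lemma pentagonE W X Y Z :
  (assoc W X Y \om idm Z) \oc assocI (W \ox X) Y Z =
  assocI W (X \ox Y) Z \oc ((W \lw assocI X Y Z) \oc assoc W X (Y \ox Z)).
Proof.
by rewrite (comp_ext (pentagonC _ _ _ _)) -!compA assocK compm1.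
Qed.

Lemma op22_lift X Y Z (c : hom (X \ox Y) (Y \ox X)) T :
  op22 (assoc Y X Z \oc (c \om idm Z) \oc assocI X Y Z) T =
  (Y \lw assocI X Z T) \oc (op22 c (Z \ox T) \oc (X \lw assoc Y Z T)).
Proof.
rewrite !op22E !rw_comp -!compA.
rewrite -pentagonB (comp_ext (esym (assoc_rw _ _ _))) -!compA.
by rewrite (comp_ext3 (pentagonA _ _ _ _)) -!compA.
Qed.

Lemma middle_swap_lift W X Y Z (c : hom (X \ox Y) (Y \ox X)) T :
  op22 (assocI W Y (X \ox Z)
      \oc (idm W \om (assoc Y X Z \oc (c \om idm Z) \oc assocI X Y Z))
      \oc assoc W X (Y \ox Z)) T =
  ((W \ox Y) \lw assocI X Z T) \oc (assocI W Y (X \ox (Z \ox T)) \oc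
    ((W \lw op22 c (Z \ox T)) \oc
      (assoc W X (Y \ox (Z \ox T)) \oc ((W \ox X) \lw assoc Y Z T)))).
Proof.
set n := assoc Y X Z \oc _ \oc _.
rewrite op22E !rw_comp -!compA pentagonE (comp_ext (esym (assocI_nat _ _ _))) -!compA.
rewrite (comp_ext3 (pentagonB _ _ _ _)) -!compA (comp_ext3 (f1 := W \lw (n \om idm T)) (h
  := W \lw op22 n T)); last first.
  by rewrite -!lw_comp -op22E.
rewrite op22_lift !lw_comp -!compA (comp_ext (assocI_lw _ _ _)) -!compA.
by rewrite assoc_lw.
Qed.

(** The left-hand side has the shape of the bialgebra axiom; lifted to tails, the middle swap
    reduces to a single crossing of adjacent factors, with no associator left. *)
Lemma op22_swap W X Y Z U V A B (c : hom (X \ox Y) (Y \ox X))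
    (p : hom A (W \ox X)) (q : hom B (Y \ox Z))
    (f : hom (W \ox Y) U) (g : hom (X \ox Z) V) T :
  op22 ((f \om g) \oc (assocI W Y (X \ox Z)
      \oc (idm W \om (assoc Y X Z \oc (c \om idm Z) \oc assocI X Y Z))
      \oc assoc W X (Y \ox Z)) \oc (p \om q)) T =
  (U \lw op21 g T) \oc (op21 f (X \ox (Z \ox T)) \oc ((W \lw op22 c (Z \ox T))
    \oc (op12 p (Y \ox (Z \ox T)) \oc (A \lw op12 q T)))).
Proof.
set ms := assocI W Y (X \ox Z) \oc _ \oc _.
have -> : op22 ((f \om g) \oc ms \oc (p \om q)) T =
    (f \om (g \om idm T)) \oc (op22 ms T \oc (p \om (q \om idm T))).
  rewrite !op22E !rw_comp -!compA (comp_ext (assoc_nat _ _ _)) -!compA.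
  by rewrite assocI_nat.
rewrite middle_swap_lift !op12E !op21E !lw_comp -!compA.
rewrite tenm_rl [p \om _]tenm_lr -!compA.
rewrite (comp_ext (interchange _ _)) -!compA; do 2!congr (_ \oc _).
by rewrite (comp_ext (esym (interchange _ _))) -!compA.
Qed.

Lemma op20_assoc X Y Z U V (f : hom (U \ox Z) I) (g : hom (X \ox Y) U)
    (f' : hom (X \ox V) I) (g' : hom (Y \ox Z) V) T :
  f \oc (g \om idm Z) = f' \oc (X \lw g') \oc assoc X Y Z ->
  op20 f T \oc op21 g (Z \ox T) = op20 f' T \oc (X \lw op21 g' T).
Proof.
move=> E; rewrite !op20E !op21E -!compA (comp_ext (assocI_rw _ _ _)) -!compA.
rewrite (comp_ext (rw_eq _ E)) !rw_comp -!compA -pentagonC lw_comp.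
by rewrite (comp_ext (assocI_nat _ _ _)) -!compA.
Qed.

(** * Sliding morphisms through the braiding *)

Section Braid.
Variable c : braiding C.

Definition br X Y T : hom (X \ox (Y \ox T)) (Y \ox (X \ox T)) :=
  locked (op22 (braid c X Y) T).

Lemma brE X Y T : br X Y T = op22 (braid c X Y) T.
Proof. by rewrite /br -lock. Qed.

Lemma br_nat X Y T T' (t : hom T T') :
  br X Y T' \oc (X \lw (Y \lw t)) = (Y \lw (X \lw t)) \oc br X Y T.
Proof. by rewrite !brE op22_nat. Qed.

Lemma br_l X X' Y (f : hom X X') T :
  br X' Y T \oc (f \om idm (Y \ox T)) = (Y \lw (f \om idm T)) \oc br X Y T.
Proof.
rewrite !brE !op22E -!compA assocI_rw (comp_ext (rw_eq _ (braid_nat _ _ _))) !rw_comp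
  -!compA.
by rewrite (comp_ext (assoc_nat _ _ _)) -!compA.
Qed.

Lemma br_r X Y Y' (f : hom Y Y') T :
  br X Y' T \oc (X \lw (f \om idm T)) = (f \om idm (X \ox T)) \oc br X Y T.
Proof.
rewrite !brE !op22E -!compA assocI_nat (comp_ext (rw_eq _ (braid_nat _ _ _))) !rw_comp
  -!compA.
by rewrite (comp_ext (assoc_rw _ _ _)) -!compA.
Qed.

Lemma br_hexR X Y Z T :
  (Y \lw br X Z T) \oc br X Y (Z \ox T) =
  assoc Y Z (X \ox T) \oc (br X (Y \ox Z) T \oc (X \lw assocI Y Z T)).
Proof.
rewrite !brE !op22E -!compA pentagonC (comp_ext (pentagon _ _ _ _)) -!compA.
have E : ((assoc Y Z X \om idm T) \oc ((braid c X (Y \ox Z) \om idm T)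
    \oc (assoc X Y Z \om idm T))) = (((Y \lw braid c X Z) \om idm T) \oc
    ((assoc Y X Z \om idm T) \oc ((braid c X Y \om idm Z) \om idm T))).
  by rewrite -!rw_comp !compA hexagon1.
rewrite (comp_ext3 E) -!compA (comp_ext (assoc_nat _ _ _)) !lw_comp -!compA.
rewrite (comp_ext (esym (pentagonA _ _ _ _))).
by rewrite -!compA (comp_ext (assoc_rw _ _ _)) -!compA (comp_ext (assocIK _ _ _)) comp1m.
Qed.

Lemma br_hexL X Y Z T :
  br X Z (Y \ox T) \oc (X \lw br Y Z T) =
  (Z \lw assoc X Y T) \oc (br (X \ox Y) Z T \oc assocI X Y (Z \ox T)).
Proof.
rewrite !brE !op22E -!compA !lw_comp.
rewrite (comp_ext (esym (pentagonB _ _ _ _))) -!compA (comp_ext (assocI_nat _ _ _)) -!compA.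
rewrite (comp_ext (esym (assoc_rw _ _ _))) -!compA pentagonI -!compA.
have E : ((braid c X Z \om idm Y) \om idm T) \oc ((assocI X Z Y \om idm T) \oc
    ((X \lw braid c Y Z) \om idm T)) = (assocI Z X Y \om idm T) \oc
    ((braid c (X \ox Y) Z \om idm T) \oc (assocI X Y Z \om idm T)).
  by rewrite -!rw_comp !compA hexagon2.
by rewrite (comp_ext3 E) -!compA (comp_ext3 (pentagonD _ _ _ _)) -!compA.
Qed.

(** A strand crosses a vertex by crossing its legs one at a time: naturality moves the vertex
    across, and a hexagon splits the crossing with a tensor product. The next three lemmas are the
    other positions of vertex and strand. *)
Lemma br_in_r X Y Z W (f : hom (Y \ox Z) W) T :
  br X W T \oc (X \lw op21 f T) =
  op21 f (X \ox T) \oc ((Y \lw br X Z T) \oc br X Y (Z \ox T)).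
Proof.
rewrite br_hexR !op21E lw_comp (comp_ext (br_r _ _ _)) -!compA.
by rewrite (comp_ext (assocK _ _ _)) comp1m.
Qed.

Lemma br_out_r X Y Z W (f : hom W (Y \ox Z)) T :
  (Y \lw br X Z T) \oc (br X Y (Z \ox T) \oc (X \lw op12 f T)) =
  op12 f (X \ox T) \oc br X W T.
Proof.
rewrite compA br_hexR -!compA !op12E lw_comp.
by rewrite (comp_ext (lw_eq _ (assocK _ _ _))) tenm_id comp1m br_r !compA.
Qed.

Lemma br_in_l X Y Z W (f : hom (X \ox Y) W) T :
  br W Z T \oc op21 f (Z \ox T) =
  (Z \lw op21 f T) \oc (br X Z (Y \ox T) \oc (X \lw br Y Z T)).
Proof.
rewrite br_hexL !op21E lw_comp (comp_ext (br_l _ _ _)) -!compA.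
by rewrite (comp_ext (lw_eq _ (assocK _ _ _))) tenm_id comp1m.
Qed.

Lemma br_out_l X Y Z W (f : hom W (X \ox Y)) T :
  br X Z (Y \ox T) \oc ((X \lw br Y Z T) \oc op12 f (Z \ox T)) =
  (Z \lw op12 f T) \oc br W Z T.
Proof.
rewrite compA br_hexL -!compA !op12E lw_comp.
by rewrite (comp_ext (assocK _ _ _)) comp1m br_l !compA.
Qed.

Lemma br_inv X Y T : exists b : hom (Y \ox (X \ox T)) (X \ox (Y \ox T)),
  b \oc br X Y T = idm _ /\ br X Y T \oc b = idm _.
Proof.
have [d [dc cd]] := braid_iso c X Y; exists (op22 d T); rewrite !brE !op22E -!compA.
rewrite !(comp_ext (assocK _ _ _)) !comp1m.
by rewrite (comp_ext (rw_eq _ dc)) (comp_ext (rw_eq _ cd)) !tenm_id !comp1m !assocIK.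
Qed.

(** Triviality of the crossing with [I] is not an axiom. Sliding a strand past [lunit I], seen as a
    product on [I], gives an equation between one crossing and two, and invertibility cancels one of
    them. Naturality along [lunit T] then reaches all tails. *)
Lemma br_unit_r X T : lunit (X \ox T) \oc br X I T = X \lw lunit T.
Proof.
have E U : lunit (X \ox (I \ox U)) \oc br X I (I \ox U) = X \lw lunit (I \ox U).
  have [b [bbr _]] := br_inv X I U; apply: (split_mono_cancel bbr).
  have := br_in_r X (lunit I) U; rewrite !op21E !lunit_assocI => ->.
  by rewrite !compA lunit_nat.
apply: (split_epi_cancel (e := X \lw (I \lw lunit T)) (s := X \lw (I \lw lunitI T))).
  by rewrite -!lw_comp lunitIK !tenm_id.
rewrite -compA br_nat (comp_ext (lunit_nat _)) -compA E -!lw_comp.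
by rewrite lunit_nat.
Qed.

Lemma br_unit_l X T : (X \lw lunit T) \oc br I X T = lunit (X \ox T).
Proof.
have E U : (X \lw lunit (I \ox U)) \oc br I X (I \ox U) = lunit (X \ox (I \ox U)).
  have [b [_ brb]] := br_inv I X U.
  apply: (split_epi_cancel (e := I \lw br I X U) (s := I \lw b)).
    by rewrite -lw_comp brb tenm_id.
  have := br_in_l X (lunit I) U; rewrite !op21E !lunit_assocI -compA => <-.
  by rewrite lunit_nat.
apply: (split_epi_cancel (e := I \lw (X \lw lunit T)) (s := I \lw (X \lw lunitI T))).
  by rewrite -!lw_comp lunitIK !tenm_id.
rewrite -compA br_nat (comp_ext (lw_eq _ (lunit_nat _))) lw_comp -compA E.
by rewrite lunit_nat.
Qed.

Lemma br_counit_r X Y (e : hom Y I) T :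
  op10 e (X \ox T) \oc br X Y T = X \lw op10 e T.
Proof. by rewrite !op10E -compA -br_r compA br_unit_r lw_comp. Qed.

Lemma br_counit_l X Y (e : hom X I) T :
  (Y \lw op10 e T) \oc br X Y T = op10 e (Y \ox T).
Proof. by rewrite !op10E lw_comp -compA -br_l compA br_unit_l. Qed.

(** A vertex without input meets no strand: [br_out_r] reduces the two crossings to one with [I],
    which is trivial. *)
Lemma br_coev_r X Y Z (f : hom I (Y \ox Z)) T :
  (Y \lw br X Z T) \oc (br X Y (Z \ox T) \oc (X \lw op02 f T)) =
  op02 f (X \ox T).
Proof.
rewrite !op02E !lw_comp (comp_ext (lw_eq _ (esym (op12E f T)))).
rewrite (comp_ext3 (br_out_r _ _ _)) op12E -!compA; do 2!congr (_ \oc _).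
apply: (split_mono_cancel (lunitK _)).
by rewrite (comp_ext (br_unit_r _ _)) -lw_comp !lunitIK tenm_id.
Qed.

End Braid.

End Lifts.

(** * Hopf algebra identities *)

Section Hopf.
Context (k : fieldType) (C : moncat k) (c : braiding C) (H : hopf_algebra c).
Implicit Types T : C.
Notation I := (unit_obj C).
Notation mu T := (op21 (amul H) T).
Notation dl T := (op12 (comul H) T).
Notation ep T := (op10 (counit H) T).
Notation et T := (op01 (aunit H) T).
Notation S T := (antipode H \om idm T).
Notation cc T := (br c H H T).

Lemma muA T : mu T \oc mu (H \ox T) = mu T \oc (H \lw mu T).
Proof. exact/op21_assoc/amulA. Qed.

Lemma dlA T : (H \lw dl T) \oc dl T = dl (H \ox T) \oc dl T.
Proof. exact/op12_assoc/comulA. Qed.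

Lemma mu1l T : mu T \oc et (H \ox T) = idm (H \ox T).
Proof. exact/op21_op01/amul1m. Qed.

Lemma mu1r T : mu T \oc (H \lw et T) = idm (H \ox T).
Proof. exact/op21_op01r/amulm1. Qed.

Lemma ep1l T : ep (H \ox T) \oc dl T = idm (H \ox T).
Proof. exact/op10_op12/counitl. Qed.

Lemma ep1r T : (H \lw ep T) \oc dl T = idm (H \ox T).
Proof. exact/op10_op12r/counitr. Qed.

Lemma antl T : mu T \oc (S (H \ox T) \oc dl T) = et T \oc ep T.
Proof. by rewrite op12_l op21_op12 op01_op10 compA antipodel. Qed.

Lemma antr T : mu T \oc ((H \lw S T) \oc dl T) = et T \oc ep T.
Proof. by rewrite op12_r op21_op12 op01_op10 compA antipoder. Qed.

Lemma epet T : ep T \oc et T = idm T.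
Proof. exact/op10_op01/counit_unit. Qed.

Lemma epmu T : ep T \oc mu T = ep T \oc ep (H \ox T).
Proof.
rewrite op10_op21 counit_mul op20E !op10E -!compA !rw_comp -!compA.
rewrite -assocI_nat (comp_ext (lunit_assocI _ _)) tenm_rl.
by rewrite (comp_ext (lunit_nat _)) -!compA.
Qed.

Lemma dlmu T : dl T \oc mu T =
  (H \lw mu T) \oc (mu (H \ox (H \ox T)) \oc ((H \lw cc (H \ox T))
    \oc (dl (H \ox (H \ox T)) \oc (H \lw dl T)))).
Proof. by rewrite op12_op21 comul_mul /middle_swap op22_swap -brE. Qed.

(** In elements, h x_1 S(x_2) = h eps(x): the antipode axiom after one use of associativity. *)
Lemma mul_antipode_r T :
  mu T \oc ((H \lw S T) \oc (mu (H \ox T) \oc (H \lw dl T))) = H \lw ep T.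
Proof.
rewrite (comp_ext (esym (op21_nat _ _))) -!compA (comp_ext (muA _)) -!compA.
by rewrite -!lw_comp antr lw_comp compA mu1r comp1m.
Qed.

(* S(a_1 x) a_2 = eps(a) S(x), both sides being S(a_1 x_1) a_2 x_2 S(x_3). *)
Lemma antipode_mul_l T :
  mu T \oc (S (H \ox T) \oc (mu (H \ox T) \oc ((H \lw cc T) \oc dl (H \ox T)))) =
  S T \oc ep (H \ox T).
Proof.
pose K := mu T \oc ((H \lw S T) \oc (mu (H \ox T) \oc (S (H \ox (H \ox T))
  \oc (dl (H \ox T) \oc (mu (H \ox T) \oc (H \lw dl T)))))).
have KA : K = S T \oc ep (H \ox T).
  rewrite /K (comp_ext3 (antl _)) -!compA.
  rewrite (comp_ext (epmu _)) -!compA (comp_ext (esym (op01_nat _ _))) -!compA.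
  by rewrite (comp_ext (mu1l _)) comp1m op10_nat (comp_ext (ep1l _)) comp1m.
rewrite -KA /K; clear K KA.
rewrite (comp_ext (dlmu _)) -!compA.
rewrite (lw_eq _ (esym (dlA _))) lw_comp.
rewrite (comp_ext (op12_nat _ _)) -!compA.
rewrite (comp_ext (lw_eq _ (br_nat _ _ _ _))) lw_comp -!compA.
rewrite (comp_ext (op21_nat _ _)) -!compA.
have E : mu T \oc ((H \lw S T) \oc (mu (H \ox T) \oc (S (H \ox (H \ox T))
    \oc ((H \lw mu (H \ox T)) \oc (H \lw (H \lw dl T)))))) =
    mu T \oc (S (H \ox T) \oc (H \lw (H \lw ep T))).
  rewrite (comp_ext (esym (op21_nat _ _))) -!compA (comp_ext (muA _)) -!compA.
  rewrite !(comp_ext (esym (interchange _ _))) -!compA.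
  rewrite (comp_ext (esym (interchange _ _))) -!compA.
  by rewrite -!lw_comp mul_antipode_r.
rewrite (comp_ext6 E).
rewrite -!compA (comp_ext (esym (op21_nat _ _))) -!compA.
rewrite (comp_ext (lw_eq _ (esym (br_nat _ _ _ _)))) lw_comp -!compA.
by rewrite (comp_ext (esym (op12_nat _ _))) -!compA -lw_comp ep1r tenm_id compm1.
Qed.

(* a_1 S(h a_2) = S(h) eps(a), both sides being S(h_1) h_2 a_1 S(h_3 a_2). *)
Lemma antipode_mul_r T :
  mu T \oc ((H \lw S T) \oc ((H \lw mu T) \oc (cc (H \ox T) \oc (H \lw dl T)))) =
  S T \oc (H \lw ep T).
Proof.
pose K := mu T \oc ((H \lw mu T) \oc ((H \lw (H \lw S T)) \oc ((H \lw dl T) \oc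
  ((H \lw mu T) \oc (S (H \ox (H \ox T)) \oc dl (H \ox T)))))).
have KA : K = S T \oc (H \lw ep T).
  rewrite /K (comp_ext3 (lw_eq3 _ (antr _))) lw_comp -!compA.
  rewrite (comp_ext (lw_eq _ (epmu _))) lw_comp -!compA.
  rewrite (comp_ext (mu1r _)) comp1m.
  rewrite (comp_ext (esym (interchange _ _))) -!compA.
  by rewrite ep1r compm1 -interchange.
rewrite -KA /K; clear K KA.
rewrite (comp_ext (lw_eq _ (dlmu _))) !lw_comp -!compA.
rewrite (comp_ext (esym (interchange _ _))) -!compA.
rewrite (comp_ext (esym (interchange (antipode H) (dl _)))) -!compA.
rewrite (comp_ext (lw_eq _ (op12_nat _ _))) lw_comp -!compA dlA.
rewrite (comp_ext (interchange _ _)) -!compA.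
rewrite (comp_ext (esym (muA _))) -!compA.
rewrite (comp_ext (op21_nat _ (S T))) -!compA.
rewrite (comp_ext (op21_nat _ (mu T))) -!compA.
rewrite (comp_ext (esym (muA _))) -!compA.
rewrite (comp_ext (op21_nat _ (cc _))) -!compA.
rewrite (comp_ext (op21_nat _ (H \lw dl T))) -!compA.
rewrite (comp_ext3 (antl _)) -!compA ep1l compm1.
rewrite -!op01_nat (comp_ext (esym (op01_nat _ (cc _)))) -!compA.
by rewrite (comp_ext (mu1l _)) comp1m.
Qed.

(** Multiplicativity of eps turns eps(S(x)) into eps(S(x_1) x_2), which the antipode axiom
    evaluates. *)
Lemma counit_antipode T : ep T \oc S T = ep T.
Proof.
have -> : ep T \oc S T = ep T \oc (mu T \oc (S (H \ox T) \oc dl T)).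
  rewrite (comp_ext (epmu _)) -(op10_nat (counit H)) -!compA.
  by rewrite (comp_ext (esym (interchange (antipode H) _))) -!compA ep1r compm1.
by rewrite antl (comp_ext (epet _)) comp1m.
Qed.

(* S(h_1) (x) h_2 a = a_1 S(h_1 a_2) (x) h_2 a_3. *)
Lemma antipode_comul_mul T :
  (H \lw mu T) \oc (S (H \ox (H \ox T)) \oc dl (H \ox T)) =
  mu (H \ox T) \oc ((H \lw S (H \ox T)) \oc ((H \lw dl T) \oc ((H \lw mu T)
    \oc (cc (H \ox T) \oc (H \lw dl T))))).
Proof.
rewrite (comp_ext (lw_eq _ (dlmu _))) !lw_comp -!compA.
rewrite (comp_ext (esym (br_nat c _ _ (dl T)))) -!compA.
rewrite (lw_eq _ (dlA _)) lw_comp.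
rewrite (comp_ext (esym (br_out_l c _ _ _))) -!compA.
rewrite (comp_ext (esym (br_nat c _ _ (cc _)))) -!compA.
rewrite (comp_ext (op12_nat _ (dl _))) -!compA.
rewrite (comp_ext3 (lw_eq3 _ (br_out_r c _ _ _))) lw_comp -!compA.
rewrite (comp_ext (lw_eq _ (interchange (antipode H) (mu T)))) lw_comp -!compA.
rewrite (comp_ext (op21_nat _ (mu T))) -!compA.
rewrite (comp_ext5 (antipode_mul_r _)) -!compA.
rewrite (comp_ext (lw_eq _ (br_counit_r c _ _ _))).
by rewrite (comp_ext (esym (op12_nat _ (ep _)))) -!compA -lw_comp ep1l tenm_id compm1.
Qed.

(* a_1 x_1 (x) S(a_2 x_2) a_3 = a x_1 (x) S(x_2). *)
Lemma antipode_mul_twist T :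
  (H \lw mu T) \oc ((H \lw S (H \ox T)) \oc (dl (H \ox T) \oc (mu (H \ox T) \oc
    ((H \lw cc T) \oc dl (H \ox T))))) =
  mu (H \ox T) \oc ((H \lw (H \lw S T)) \oc (H \lw dl T)).
Proof.
rewrite (comp_ext (dlmu _)) -!compA.
rewrite (comp_ext (lw_eq _ (esym (br_out_r c _ _ _)))) !lw_comp -!compA.
rewrite -op12_nat.
rewrite (comp_ext (op12_nat _ (H \lw cc _))) -!compA.
rewrite (comp_ext (op12_nat _ (cc _))) -!compA.
rewrite (comp_ext (esym (dlA _))) -!compA.
rewrite (comp_ext (lw_eq _ (br_nat c _ _ (cc _)))) lw_comp -!compA.
rewrite (comp_ext3 (lw_eq3 _ (br_out_l c _ _ _))) lw_comp -!compA.
rewrite (comp_ext (op21_nat _ (H \lw cc _))) -!compA.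
rewrite (comp_ext (op21_nat _ (dl _))) -!compA.
rewrite (comp_ext5 (lw_eq5 _ (antipode_mul_l _))) lw_comp -!compA.
rewrite (comp_ext (esym (op21_nat _ (ep _)))) -!compA.
rewrite (comp_ext (lw_eq _ (br_counit_l c _ _ _))).
rewrite (comp_ext (ep1r _)) comp1m.
by rewrite (comp_ext (esym (op21_nat _ (S T)))) -!compA.
Qed.

Section Module.
Variables (Y : rmodule H) (phi : @hom k C Y H).
Notation act T := (op21 (ract Y) T).
Notation phT T := (phi \om idm T).

Lemma actA T : act T \oc act (H \ox T) = act T \oc (Y \lw mu T).
Proof. exact/op21_assoc/ractA. Qed.

(* y x |-> phi(y x_1) S(x_2). *)
Definition act_conv T : hom (Y \ox (H \ox T)) (H \ox T) := locked
  (mu T \oc ((H \lw S T) \oc (phT (H \ox T) \oc (act (H \ox T) \oc (Y \lw dl T))))).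

Lemma act_convE T : act_conv T =
  mu T \oc ((H \lw S T) \oc (phT (H \ox T) \oc (act (H \ox T) \oc (Y \lw dl T)))).
Proof. by rewrite /act_conv -lock. Qed.

Lemma act_conv_nat T T' (t : hom T T') : act_conv T' \oc (Y \lw (H \lw t)) = (H \lw t) \oc
  act_conv T.
Proof.
rewrite !act_convE -!compA (lw_eq _ (op12_nat _ t)) lw_comp.
rewrite (comp_ext (op21_nat _ (H \lw t))) -!compA.
rewrite (comp_ext (interchange phi (H \lw t))) -!compA.
rewrite (comp_ext (lw_eq _ (interchange (antipode H) t))) lw_comp -!compA.
by rewrite (comp_ext (op21_nat _ t)) -!compA.
Qed.

(* With P = act_conv: P(y, a_1 x) a_2 = P(y a, x). *)
Lemma act_conv_mul T :
  mu T \oc (act_conv (H \ox T) \oc ((Y \lw mu (H \ox T)) \oc ((Y \lw (H \lw cc T)) \oc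
    (Y \lw dl (H \ox T))))) = act_conv T \oc act (H \ox T).
Proof.
rewrite !act_convE -!compA (comp_ext (muA _)) -!compA.
rewrite (comp_ext (esym (interchange phi (S (H \ox T))))) -!compA.
rewrite (comp_ext (esym (interchange phi (mu T)))) -!compA.
rewrite (comp_ext (esym (op21_nat _ (S _)))) -!compA.
rewrite (comp_ext (esym (op21_nat _ (mu _)))) -!compA.
rewrite (lw_eq6 _ (antipode_mul_twist _)) !lw_comp.
rewrite (comp_ext (esym (actA _))) -!compA.
rewrite (comp_ext (op21_nat _ (H \lw S T))) -!compA.
rewrite (op21_nat _ (dl T)).
by rewrite (comp_ext (op21_nat _ (S T))) -!compA (comp_ext (interchange phi (S T))) -!compA.
Qed.

(** For linear [phi] one has phi(y x_1) S(x_2) = phi(y) x_1 S(x_2), and the antipode axiom leaves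
    phi(y) eps(x). *)
Lemma act_conv_linear T :
  (forall T, phT T \oc act T = mu T \oc phT (H \ox T)) ->
  act_conv T = (H \lw ep T) \oc phT (H \ox T).
Proof.
move=> lin; rewrite act_convE (comp_ext (lin _)) -!compA interchange.
by rewrite (comp_ext4 (mul_antipode_r _)).
Qed.

Variables (D : C) (ev : hom (D \ox H) I) (coev : hom I (H \ox D)).
Hypothesis zigL : lunit D \oc (ev \om idm D) \oc assocI D H D \oc (idm D \om coev) = runit
  D.
Hypothesis zigR : runit H \oc (idm H \om ev) \oc assoc H D H \oc (coev \om idm H) = lunit H.
Notation evT T := (op20 ev T).
Notation coT T := (op02 coev T).

(** The coevaluation supplies the traced variable x together with its dual strand. The crossing
    carries h = [act_conv](y, x) past the dual strand, so that the latter stands directly before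
    S(h_1) and [ev] can close the loop, leaving h_2. *)
Definition ptrace T : hom (Y \ox T) (H \ox T) := locked
  (evT (H \ox T) \oc ((D \lw S (H \ox T)) \oc ((D \lw dl T) \oc
    (br c H D T \oc (act_conv (D \ox T) \oc (Y \lw coT T)))))).

Lemma ptraceE T : ptrace T = evT (H \ox T) \oc ((D \lw S (H \ox T)) \oc ((D \lw dl T) \oc
    (br c H D T \oc (act_conv (D \ox T) \oc (Y \lw coT T))))).
Proof. by rewrite /ptrace -lock. Qed.

Lemma ptrace_nat T T' (t : hom T T') : ptrace T' \oc (Y \lw t) = (H \lw t) \oc ptrace T.
Proof.
rewrite !ptraceE -!compA (lw_eq _ (op02_nat _ t)) lw_comp.
rewrite (comp_ext (act_conv_nat (D \lw t))) -!compA.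
rewrite (comp_ext (br_nat c _ _ t)) -!compA.
rewrite (comp_ext (lw_eq _ (op12_nat _ t))) lw_comp -!compA.
rewrite (comp_ext (lw_eq _ (interchange (antipode H) (H \lw t)))) lw_comp -!compA.
by rewrite (comp_ext (op20_nat _ (H \lw t))) -!compA.
Qed.

Section DualAction.
Variable dact0 : hom (D \ox H) D.
Hypothesis dact0E : ev \oc (dact0 \om idm H) = ev \oc (D \lw amul H) \oc assoc D H H.
Notation dact T := (op21 dact0 T).

Lemma ev_dact T : evT T \oc dact (H \ox T) = evT T \oc (D \lw mu T).
Proof. exact: op20_assoc. Qed.

(** [dact0] is adjoint to left multiplication with respect to [ev], hence also with respect to
    [coev]: one zigzag is inserted on the dual strand to make [ev_dact] applicable, and the other
    removes it. *)
Lemma dact_coev T : (H \lw dact T) \oc coT (H \ox T) = mu (D \ox T) \oc (H \lw coT T).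
Proof.
have zL : evT (D \ox T) \oc (D \lw coT T) = idm _ by apply: zigzag_left.
rewrite -[H \lw dact T]comp1m -[in LHS]tenm_id -zL lw_comp -!compA.
rewrite (comp_ext (lw_eq _ (esym (op21_nat dact0 (coT T))))) lw_comp -!compA.
rewrite (comp_ext (lw_eq _ (ev_dact _))) lw_comp -!compA.
rewrite -op02_nat (comp_ext (esym (op02_nat _ (mu _)))) -!compA.
by rewrite (comp_ext (zigzag_right _ zigR)) comp1m.
Qed.

Lemma ptrace_act T : mu T \oc ptrace (H \ox T) = ptrace T \oc act T.
Proof.
rewrite !ptraceE -!compA (comp_ext (esym (op20_nat _ (mu T)))) -!compA.
rewrite (comp_ext3 (lw_eq3 _ (antipode_comul_mul _))) !lw_comp -!compA.
(* First half of cyclicity: the factor a_1 in front of S is handed to the dual strand, where it acts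
   through [dact0]. *)
rewrite (comp_ext (esym (ev_dact _))) -!compA.
rewrite (comp_ext (op21_nat dact0 (S _))) -!compA.
rewrite (comp_ext (op21_nat dact0 (dl _))) -!compA.
rewrite (comp_ext (op21_nat dact0 (mu _))) -!compA.
rewrite (comp_ext (esym (br_nat c _ _ (dl T)))) -!compA.
rewrite (comp_ext3 (esym (br_in_r c _ _ _))) -!compA.
rewrite (comp_ext (esym (act_conv_nat (D \lw dl T)))) -!compA.
rewrite (comp_ext (esym (act_conv_nat (dact _)))) -!compA.
rewrite (lw_eq _ (esym (op02_nat coev (dl T)))).
(* Second half of cyclicity: at the coevaluation, the action on the dual strand becomes left
   multiplication of x by a_1. *)
rewrite (lw_eq _ (comp_ext (dact_coev _) (dl T))) !lw_comp -!compA.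
(* The pair x and its dual is now created to the right of a_2, which then crosses both. The crossing
   with x is the one in [act_conv_mul]; the one with the dual strand merges with that of h, by
   [br_in_l], into a crossing of the product h a_2. *)
rewrite -(br_coev_r c H coev T) !lw_comp -!compA.
rewrite (lw_eq _ (esym (op12_nat (comul H) (coT T)))) lw_comp.
rewrite (comp_ext (lw_eq _ (op21_nat (amul H) (br c H D T)))) lw_comp -!compA.
rewrite (comp_ext (act_conv_nat (br c H D T))) -!compA.
rewrite (comp_ext3 (esym (br_in_l c _ _ _))) -!compA.
rewrite (comp_ext5 (act_conv_mul _)) -!compA.
by rewrite op21_nat.
Qed.
End DualAction.

Lemma ptrace_linear T :
  (forall T, phT T \oc act T = mu T \oc phT (H \ox T)) -> ptrace T = phT T.
Proof.
move=> lin; rewrite ptraceE (act_conv_linear _ lin) -!compA interchange.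
(* A crossing of h with x costs nothing, since eps erases x. Together with the crossing of h with
   the dual strand it lets the coevaluation slide to the left of h, where the zigzag identity
   straightens the loop and leaves eps(S(h_1)) h_2. *)
rewrite -(br_counit_r c) -!compA (comp_ext (esym (op10_nat _ (br c H D T)))) -!compA.
rewrite (comp_ext3 (br_coev_r c _ _ _)).
rewrite (comp_ext (esym (op10_nat _ (D \lw dl T)))) -!compA.
rewrite (comp_ext (esym (op10_nat _ (D \lw S (H \ox T))))) -!compA.
rewrite (comp_ext (esym (op10_nat _ (evT (H \ox T))))) -!compA.
rewrite (comp_ext (esym (op02_nat coev (dl T)))) -!compA.
rewrite (comp_ext (esym (op02_nat coev (S _)))) -!compA.
rewrite (comp_ext (zigzag_right _ zigR)) comp1m.
by rewrite (comp_ext (counit_antipode _)) (comp_ext (ep1l _)) comp1m.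
Qed.

End Module.
End Hopf.

(** * The partial trace as a morphism of C *)

Section Strength.
Context (k : fieldType) (C : moncat k).
Implicit Types X Y Z U V W T : C.
Notation I := (unit_obj C).

Fixpoint wten (w : seq C) T : C := if w is X :: w' then X \ox wten w' T else T.

Fixpoint wassoc (w : seq C) T W : hom (wten w T \ox W) (wten w (T \ox W)) :=
  match w with
  | [::] => idm (T \ox W)
  | X :: w' => (X \lw wassoc w' T W) \oc assoc X (wten w' T) W
  end.

(* Compatibility with tensoring on the right; a natural family with this property
   is determined by its value at the tail [unit_obj C]. *)
Definition strong (w v : seq C) (f : forall T, hom (wten w T) (wten v T)) : Prop :=
  forall T W, f (T \ox W) \oc wassoc w T W = wassoc v T W \oc (f T \om idm W).

Lemma strong_comp (w v u : seq C) (g : forall T, hom (wten v T) (wten u T))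
    (f : forall T, hom (wten w T) (wten v T)) :
  strong g -> strong f -> @strong w u (fun T => g T \oc f T).
Proof.
by move=> sg sf T W; rewrite -compA sf compA sg -compA -rw_comp.
Qed.

Lemma strong_ext (w v : seq C) (f g : forall T, hom (wten w T) (wten v T)) :
  (forall T, f T = g T) -> strong g -> strong f.
Proof. by move=> fg sg T W; rewrite !fg. Qed.

Lemma strong_lw X (w v : seq C) (f : forall T, hom (wten w T) (wten v T)) :
  strong f -> @strong (X :: w) (X :: v) (fun T => X \lw f T).
Proof.
move=> sf T W /=; rewrite -[RHS]compA assoc_nat !compA; congr (_ \oc _).
by rewrite -!lw_comp sf.
Qed.

Lemma pentagonF W X Y Z :
  assocI W X (Y \ox Z) \oc ((W \lw assoc X Y Z) \oc assoc W (X \ox Y) Z) =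
  assoc (W \ox X) Y Z \oc (assocI W X Y \om idm Z).
Proof. by rewrite -pentagonD (comp_ext (assocK _ _ _)) comp1m. Qed.

Lemma strong_op11 X Y (f : hom X Y) (u : seq C) :
  @strong (X :: u) (Y :: u) (fun T => f \om idm (wten u T)).
Proof.
move=> T W /=; rewrite (comp_ext (interchange f _)) -!compA; congr (_ \oc _).
by rewrite assoc_rw.
Qed.

Lemma strong_op12 X Y Z (f : hom Z (X \ox Y)) (u : seq C) :
  @strong (Z :: u) (X :: Y :: u) (fun T => op12 f (wten u T)).
Proof.
move=> T W /=; rewrite (comp_ext (op12_nat f _)) !lw_comp -!compA; congr (_ \oc _).
rewrite !op12E rw_comp -!compA -assoc_rw.
by rewrite (comp_ext (pentagon _ _ _ _)) -!compA.
Qed.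

Lemma strong_op21 X Y Z (f : hom (X \ox Y) Z) (u : seq C) :
  @strong (X :: Y :: u) (Z :: u) (fun T => op21 f (wten u T)).
Proof.
move=> T W /=; rewrite !lw_comp -!compA (comp_ext (op21_nat f _)) -!compA.
congr (_ \oc _).
by rewrite !op21E rw_comp -!compA pentagonF (comp_ext (esym (assoc_rw _ _ f))) -!compA.
Qed.

Lemma strong_op22 X Y Z V (f : hom (X \ox Y) (Z \ox V)) (u : seq C) :
  @strong (X :: Y :: u) (Z :: V :: u) (fun T => op22 f (wten u T)).
Proof.
move=> T W /=; rewrite !lw_comp -!compA (comp_ext (op22_nat f _)) -!compA.
congr (_ \oc _).
rewrite !op22E !rw_comp -!compA pentagonF (comp_ext (esym (assoc_rw _ _ f))) -!compA.
by rewrite (comp_ext (pentagon _ _ _ _)) -!compA.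
Qed.

Lemma strong_op20 X Y (f : hom (X \ox Y) I) (u : seq C) :
  @strong (X :: Y :: u) u (fun T => op20 f (wten u T)).
Proof.
move=> T W /=; rewrite !lw_comp -!compA (comp_ext (op20_nat f _)) -!compA.
congr (_ \oc _).
rewrite !op20E !rw_comp -!compA pentagonF (comp_ext (esym (assoc_rw _ _ f))) -!compA.
by rewrite (comp_ext (lunit_assoc _ _)).
Qed.

Lemma strong_op02 X Y (f : hom I (X \ox Y)) (u : seq C) :
  @strong u (X :: Y :: u) (fun T => op02 f (wten u T)).
Proof.
move=> T W /=; rewrite op02_nat !lw_comp -!compA; congr (_ \oc _).
rewrite !op02E !rw_comp -lunitI_assoc (comp_ext (esym (assoc_rw _ _ f))) -!compA.
by rewrite (comp_ext (pentagon _ _ _ _)) -!compA.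
Qed.

(** Strength with tail [I] and right factor [T] computes the family at [I \ox T]; naturality along
    [lunit T] and the triangle bring this back to [T]. *)
Lemma strong_unit X Y (f : forall T, hom (X \ox T) (Y \ox T)) :
  (forall T T' (t : hom T T'), f T' \oc (X \lw t) = (Y \lw t) \oc f T) ->
  @strong [:: X] [:: Y] f ->
  forall T, f T = (runit Y \oc f I \oc runitI X) \om idm T.
Proof.
move=> fn fs T.
apply: (split_epi_cancel (e := runit X \om idm T) (s := runitI X \om idm T)).
  by rewrite -rw_comp runitIK tenm_id.
rewrite -rw_comp -!compA runitK compm1 rw_comp -!triangle.
rewrite compA fn -!compA; congr (_ \oc _).
by have := fs I T; rewrite /= !tenm_id !comp1m.
Qed.

End Strength.

Section Faithful.
Context (k : fieldType) (C : moncat k).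
Implicit Types X Y Z T : C.
Notation I := (unit_obj C).

(** This allows identities proved for families with tails to descend to the underlying morphisms. *)
Lemma op21_inj X Y Z (f g : hom (X \ox Y) Z) : op21 f I = op21 g I -> f = g.
Proof.
rewrite !op21E => fg; apply: rw_unit_inj.
exact: (split_epi_cancel (assocK X Y I)) fg.
Qed.

Lemma op12_inj X Y Z (f g : hom Z (X \ox Y)) : op12 f I = op12 g I -> f = g.
Proof.
rewrite !op12E => fg; apply: rw_unit_inj.
exact: (split_mono_cancel (assocK X Y I)) fg.
Qed.

End Faithful.

(** * Duality *)

Section Duality.
Context (k : fieldType) (C : moncat k) (L R : C).
Implicit Types X Y Z V T : C.
Notation I := (unit_obj C).
Variables (ev : hom (L \ox R) I) (coev : hom I (R \ox L)).
Hypothesis zigR : runit R \oc (R \lw ev) \oc assoc R L R \oc (coev \om idm R) = lunit R.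
Hypothesis zigL : lunit L \oc (ev \om idm L) \oc assocI L R L \oc (L \lw coev) = runit L.

(** [evr] and [coevr] are the two directions of the adjunction between tensoring on the right with
    [R] and with [L]; [evl] and [coevl] are those of the adjunction between tensoring on the left
    with [L] and with [R]. *)
Definition evr V X (t : hom X (V \ox L)) : hom (X \ox R) V :=
  runit V \oc (V \lw ev) \oc assoc V L R \oc (t \om idm R).

Definition coevr V X (p : hom (X \ox R) V) : hom X (V \ox L) :=
  (p \om idm L) \oc assocI X R L \oc (X \lw coev) \oc runitI X.

Definition evl V X (s : hom X (R \ox V)) : hom (L \ox X) V :=
  lunit V \oc (ev \om idm V) \oc assocI L R V \oc (L \lw s).

Definition coevl V X (p : hom (L \ox X) V) : hom X (R \ox V) :=
  (R \lw p) \oc assoc R L X \oc (coev \om idm X) \oc lunitI X.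

(** In tail form a mate is a plain composite free of associators, so that the inversion laws below
    reduce to naturality and one zigzag. *)
Lemma op21_evr V X (t : hom X (V \ox L)) T :
  op21 (evr t) T = (V \lw op20 ev T) \oc op12 t (R \ox T).
Proof.
rewrite op21E op20E op12E /evr !rw_comp !lw_comp -!compA -assocI_rw.
rewrite (comp_ext (pentagonE _ _ _ _)) -!compA (comp_ext (esym (assocI_nat _ _ _))) -!compA.
by rewrite (comp_ext (runit_assocI _ _)).
Qed.

Lemma op12_coevr V X (p : hom (X \ox R) V) T :
  op12 (coevr p) T = op21 p (L \ox T) \oc (X \lw op02 coev T).
Proof.
rewrite op21E op12E op02E /coevr !rw_comp !lw_comp -!compA.
rewrite (comp_ext (assoc_rw _ _ _)) -!compA -triangle_lunitI.
rewrite (comp_ext (esym (assoc_nat _ _ _))) -!compA.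
by rewrite (comp_ext3 (pentagonF _ _ _ _)) -!compA.
Qed.

Lemma op21_evl V X (s : hom X (R \ox V)) T :
  op21 (evl s) T = op20 ev (V \ox T) \oc (L \lw op12 s T).
Proof.
rewrite op21E op20E op12E /evl !rw_comp !lw_comp -!compA -assocI_nat.
rewrite (comp_ext (esym (pentagonB _ _ _ _))) -!compA (comp_ext (esym (assoc_rw _ _ ev))).
by rewrite -!compA (comp_ext (lunit_assoc _ _)).
Qed.

Lemma op12_coevl V X (p : hom (L \ox X) V) T :
  op12 (coevl p) T = (R \lw op21 p T) \oc op02 coev (X \ox T).
Proof.
rewrite op21E op12E op02E /coevl !rw_comp !lw_comp -!compA -lunitI_assoc.
rewrite (comp_ext (esym (assoc_rw _ _ coev))) -!compA (comp_ext3 (pentagonA _ _ _ _))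
  -!compA.
by rewrite (comp_ext (assoc_nat _ _ _)) -!compA.
Qed.

Lemma evrK V X (t : hom X (V \ox L)) : coevr (evr t) = t.
Proof.
apply: op12_inj; rewrite op12_coevr op21_evr -compA op12_nat compA -lw_comp.
by rewrite zigzag_left // tenm_id comp1m.
Qed.

Lemma coevrK V X (p : hom (X \ox R) V) : evr (coevr p) = p.
Proof.
apply: op21_inj; rewrite op21_evr op12_coevr compA -op21_nat -compA -lw_comp.
by rewrite zigzag_right // tenm_id compm1.
Qed.

Lemma evlK V X (s : hom X (R \ox V)) : coevl (evl s) = s.
Proof.
apply: op12_inj; rewrite op12_coevl op21_evl lw_comp -compA -op02_nat compA.
by rewrite zigzag_right // comp1m.
Qed.

Lemma coevlK V X (p : hom (L \ox X) V) : evl (coevl p) = p.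
Proof.
apply: op21_inj; rewrite op21_evl op12_coevl lw_comp compA op20_nat -compA.
by rewrite zigzag_left // compm1.
Qed.

Lemma evr_comp V X Y (t : hom X (V \ox L)) (x : hom Y X) :
  evr (t \oc x) = evr t \oc (x \om idm R).
Proof. by rewrite /evr rw_comp !compA. Qed.

Lemma evl_comp V X Y (s : hom X (R \ox V)) (x : hom Y X) :
  evl (s \oc x) = evl s \oc (L \lw x).
Proof. by rewrite /evl lw_comp !compA. Qed.

Lemma coevl_comp V X Y (p : hom (L \ox X) V) (x : hom Y X) :
  coevl (p \oc (L \lw x)) = coevl p \oc x.
Proof. by rewrite -[in LHS](coevlK p) -evl_comp evlK. Qed.

Lemma evr_inj V X (t t' : hom X (V \ox L)) : evr t = evr t' -> t = t'.
Proof. by move=> /(congr1 (@coevr _ _)); rewrite !evrK. Qed.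

Lemma evl_inj V X (s s' : hom X (R \ox V)) : evl s = evl s' -> s = s'.
Proof. by move=> /(congr1 (@coevl _ _)); rewrite !evlK. Qed.

Lemma evr0 V X : evr (0 : hom X (V \ox L)) = 0.
Proof. by rewrite /evr ten0m compm0. Qed.

Lemma evr_unit X (t : hom X (I \ox L)) : evr t = ev \oc ((lunit L \oc t) \om idm R).
Proof.
by rewrite /evr runit_unit lunit_nat -!compA (comp_ext (lunit_assoc _ _)) -rw_comp.
Qed.

Lemma evl_unit X (s : hom X (R \ox I)) : evl s = ev \oc (L \lw (runit R \oc s)).
Proof.
rewrite /evl -runit_unit runit_nat -!compA -assoc_runit -!compA (comp_ext (assocIK _ _ _)).
by rewrite comp1m -lw_comp.
Qed.

(** The adjunctions at [V = I], with the unitor absorbed: this lemma and the next three say that the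
    pairing [ev] is perfect in each argument. *)
Lemma pair_left X (p : hom (X \ox R) I) : exists t : hom X L, ev \oc (t \om idm R) = p.
Proof. by exists (lunit L \oc coevr p); rewrite -evr_unit coevrK. Qed.

Lemma pair_left_inj X (t t' : hom X L) :
  ev \oc (t \om idm R) = ev \oc (t' \om idm R) -> t = t'.
Proof.
have E (u : hom X L) : u = lunit L \oc (lunitI L \oc u).
  by rewrite compA lunitIK comp1m.
by rewrite [in LHS](E t) [in RHS](E t') -!evr_unit => /(congr1 (@coevr _ _));
  rewrite !evrK => tt; rewrite (E t) (E t') tt.
Qed.

Lemma pair_right X (p : hom (L \ox X) I) : exists s : hom X R, ev \oc (L \lw s) = p.
Proof. by exists (runit R \oc coevl p); rewrite -evl_unit coevlK. Qed.

Lemma pair_right_inj X (s s' : hom X R) :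
  ev \oc (L \lw s) = ev \oc (L \lw s') -> s = s'.
Proof.
have E (u : hom X R) : u = runit R \oc (runitI R \oc u).
  by rewrite compA runitIK comp1m.
by rewrite [in LHS](E s) [in RHS](E s') -!evl_unit => /(congr1 (@coevl _ _));
  rewrite !evlK => tt; rewrite (E s) (E s') tt.
Qed.

End Duality.

Section Retraction.
Context (k : fieldType) (C : moncat k) (c : braiding C) (H : hopf_algebra c).
Notation I := (unit_obj C).
Variables (D : C) (ev : hom (D \ox H) I) (coev : hom I (H \ox D)).
Hypothesis zigR : runit H \oc (idm H \om ev) \oc assoc H D H \oc (coev \om idm H) = lunit H.
Hypothesis zigL : lunit D \oc (ev \om idm D) \oc assocI D H D \oc (idm D \om coev) = runit
  D.

(** Strength passes through composition and left tensoring, so it is checked factor by factor; the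
    explicit words list the strands present before and after each factor. *)
Lemma ptrace_strong (Y : rmodule H) (phi : @hom k C Y H) :
  strong (w := [:: rm_obj Y]) (v := [:: alg_obj H]) (ptrace phi ev coev).
Proof.
pose h : C := alg_obj H; pose y : C := rm_obj Y.
have sph : @strong k C [:: y; h; D] [:: h; D] (fun T => act_conv phi (D \ox T)).
  apply: strong_ext => [T|]; first exact: act_convE.
  apply: (@strong_comp k C [:: y; h; D] [:: h; h; D] [:: h; D] (fun T => op21 (amul H) (D
    \ox T))).
    exact: (strong_op21 _ [:: D]).
  apply: (@strong_comp k C [:: y; h; D] [:: h; h; D] [:: h; h; D] (fun T => h \lw
    (antipode H \om idm (D \ox T)))).
    exact/(@strong_lw k C h [:: h; D] [:: h; D])/(strong_op11 _ [:: D]).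
  apply: (@strong_comp k C [:: y; h; D] [:: y; h; D] [:: h; h; D] (fun T => phi \om idm (H
    \ox (D \ox T)))).
    exact: (strong_op11 _ [:: h; D]).
  apply: (@strong_comp k C [:: y; h; D] [:: y; h; h; D] [:: y; h; D] (fun T => op21 (ract
    Y) (H \ox (D \ox T)))).
    exact: (strong_op21 _ [:: h; D]).
  exact/(@strong_lw k C y [:: h; D] [:: h; h; D])/(strong_op12 _ [:: D]).
apply: strong_ext => [T|]; first exact: ptraceE.
apply: (@strong_comp k C [:: y] [:: D; h; h] [:: h] (fun T => op20 ev (H \ox T))).
  exact: (strong_op20 _ [:: h]).
apply: (@strong_comp k C [:: y] [:: D; h; h] [:: D; h; h] (fun T => D \lw (antipode H \om
  idm (H \ox T)))).
  exact/(@strong_lw k C D [:: h; h] [:: h; h])/(strong_op11 _ [:: h]).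
apply: (@strong_comp k C [:: y] [:: D; h] [:: D; h; h] (fun T => D \lw op12 (comul H) T)).
  exact/(@strong_lw k C D [:: h] [:: h; h])/(strong_op12 _ [::]).
apply: (@strong_comp k C [:: y] [:: h; D] [:: D; h] (fun T => br c H D T)).
  by apply: strong_ext => [T|]; [exact: brE | exact: (strong_op22 _ [::])].
apply: (@strong_comp k C [:: y] [:: y; h; D] [:: h; D] (fun T => act_conv phi (D \ox T)))
  => //.
exact/(@strong_lw k C y [::] [:: h; D])/(strong_op02 _ [::]).
Qed.

(** The one morphism that induces the whole family [ptrace], read off at the tail [I]. *)
Definition retr (Y : rmodule H) (phi : @hom k C Y H) : @hom k C Y H :=
  runit H \oc ptrace phi ev coev I \oc runitI Y.

Lemma ptrace_retr (Y : rmodule H) (phi : @hom k C Y H) T :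
  ptrace phi ev coev T = retr phi \om idm T.
Proof. by apply: strong_unit; [move=> *; apply: ptrace_nat | apply: ptrace_strong]. Qed.

Lemma retr_act (Y : rmodule H) (phi : @hom k C Y H) :
  retr phi \oc ract Y = amul H \oc (retr phi \om idm H).
Proof.
(* The right action of [H] on its dual that moves a factor around the trace: perfectness of [ev]
   provides the adjoint of left multiplication. *)
have [dact dactE] := pair_left zigR (ev \oc (D \lw amul H) \oc assoc D H H).
apply: op21_inj; rewrite -op21_l.
have := ptrace_act phi zigL zigR dactE I; rewrite !ptrace_retr => ->.
by rewrite !op21E rw_comp -!compA.
Qed.

Lemma retr_id (Y : rmodule H) (phi : @hom k C Y H) :
  phi \oc ract Y = amul H \oc (phi \om idm H) -> retr phi = phi.
Proof.
move=> lin; apply: rw_unit_inj; rewrite -ptrace_retr.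
apply: ptrace_linear => // T.
by rewrite op21_l -lin !op21E rw_comp -!compA.
Qed.

(** [Y] enters [ptrace] only through [phi] and the action inside [act_conv], and a linear [f]
    commutes with that action. *)
Lemma retr_nat (Y Y' : rmodule H) (phi : @hom k C Y H) (f : @hom k C Y' Y) :
  f \oc ract Y' = ract Y \oc (f \om idm H) -> retr (phi \oc f) = retr phi \oc f.
Proof.
move=> lin; apply: rw_unit_inj; rewrite rw_comp -!ptrace_retr !ptraceE -!compA.
rewrite -(interchange f (op02 coev I)).
rewrite (comp_ext (f0 := act_conv phi _) (f1 := f \om _) (h := act_conv (phi \oc f) (D \ox
  I))) //.
rewrite !act_convE -!compA -(interchange f) rw_comp -!compA.
by rewrite !(comp_ext (op21_l _ _ _)) -lin !op21E rw_comp -!compA.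
Qed.

End Retraction.

(** * Kernels and internal Homs *)

Definition has_kernels (k : fieldType) (C : lincat k) : Prop :=
  forall (X Y : C) (f : hom X Y), exists (K : C) (i : hom K X), is_kernel i f.

Section FdmodKernel.
Context (k : fieldType) (A : falgType k) (M N : fdmod A) (f : fdhom M N).

Let U := lker (fdhom_val f).

Lemma fdhom_act (g : fdhom M N) v a : g (fd_act v a) = fd_act (g v) a.
Proof. by have /asboolP -> := fdhom_valP g. Qed.

Lemma fd_act0 a : fd_act (0 : N) a = 0.
Proof.
by have := fd_act_linl (-1) (0 : N) 0 a; rewrite scaler0 addr0 scaleN1r addNr.
Qed.

Lemma lker_act (v : M) a : v \in U -> fd_act v a \in U.
Proof. by rewrite !memv_ker fdhom_act => /eqP ->; rewrite fd_act0. Qed.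

(** [vsproj] merely retypes the vector: the kernel is stable under the action, and the projection is
    the identity on it. *)
Definition ker_act (v : subvs_of U) (a : A) : subvs_of U :=
  vsproj U (fd_act (vsval v) a).

Lemma vsval_ker_act v a : vsval (ker_act v a) = fd_act (vsval v) a.
Proof. by rewrite vsprojK // lker_act // subvsP. Qed.

Definition ker_fdmod : fdmod A.
Proof.
refine (@FdMod k A (subvs_of U) ker_act _ _ _ _).
- by move=> c v w a; apply: val_inj; rewrite /= !vsval_ker_act -fd_act_linl.
- by move=> c v a b; apply: val_inj; rewrite /= !vsval_ker_act fd_act_linr.
- by move=> v; apply: val_inj; rewrite /= vsval_ker_act fd_act1.
- by move=> v a b; apply: val_inj; rewrite /= !vsval_ker_act fd_actM.
Defined.

Lemma ker_incP : linfun (vsval : subvs_of U -> M) \in fdhom_pred (M := ker_fdmod) (N := M).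
Proof. by apply/asboolP => v a; rewrite !lfunE /= vsval_ker_act. Qed.

Definition ker_inc : hom (ker_fdmod : fdmod_cat A) M := FdHom ker_incP.

End FdmodKernel.

Lemma fdmod_kernels (k : fieldType) (A : falgType k) : has_kernels (fdmod_cat A).
Proof.
move=> M N f; exists (ker_fdmod f), (ker_inc f); split.
  apply: val_inj; apply/lfunP => v; rewrite /= comp_lfunE lfunE /= zero_lfunE.
  by apply/eqP; rewrite -memv_ker subvsP.
move=> Z h fh0.
have hU (v : Z) : (h : fdhom Z M) v \in lker (fdhom_val f).
  rewrite memv_ker -comp_lfunE; apply/eqP.
  by have := congr1 (fun g : fdhom Z N => fdhom_val g v) fh0; rewrite /= zero_lfunE.
have hK v : vsval (vsproj (lker (fdhom_val f)) ((h : fdhom Z M) v)) = (h : fdhom Z M) v.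
  by rewrite vsprojK.
pose t0 := linfun (vsproj (lker (fdhom_val f)) \o (h : fdhom Z M)).
have tP : (t0 : 'Hom(Z, ker_fdmod f)) \in fdhom_pred (M := Z) (N := ker_fdmod f).
  apply/asboolP => v a; apply: val_inj; rewrite /= !lfunE /= hK.
  by rewrite vsval_ker_act hK; have /asboolP -> := fdhom_valP h.
exists (FdHom tP); split.
  by apply: val_inj; apply/lfunP => v; rewrite /= comp_lfunE !lfunE /= hK.
move=> t ft; apply: val_inj; apply/lfunP => v; apply: val_inj.
rewrite /= lfunE /= hK -ft /= comp_lfunE lfunE.
done.
Qed.

Lemma linear_functor0 (k : fieldType) (C D : lincat k) (F : functor C D) :
  linear_functor F -> forall X Y : C, fmap F (0 : hom X Y) = 0.
Proof.
move=> Flin X Y; have := Flin X Y (-1) 0 0.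
by rewrite scaler0 addr0 scaleN1r addNr.
Qed.

(** A kernel of [fmap F f] is carried back by [G] and corrected by [eta]. Uniqueness of
    factorisations is tested after the faithful functor [F], where [th] identifies the carried-back
    inclusion with the original monomorphism. *)
Lemma equivalent_kernels (k : fieldType) (C D : lincat k) :
  equivalent C D -> has_kernels D -> has_kernels C.
Proof.
move=> [F [G [Flin Glin [eta [eta_iso eta_nat]] [th [th_iso th_nat]]]]] kerD X Y f.
have [K [i [fi0 iU]]] := kerD _ _ (fmap F f).
have F_inj (Z W : C) (a b : hom Z W) : fmap F a = fmap F b -> a = b.
  have [e [e1 e2]] := eta_iso Z => Fab.
  apply: (split_epi_cancel e2).
  by have := eta_nat _ _ a; have := eta_nat _ _ b; rewrite /= Fab => <- <-.
have i_mono (Z : D) (a b : hom Z K) : i \oc a = i \oc b -> a = b.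
  move=> iab; have [|t [_ tU]] := iU Z (i \oc a); first by rewrite compA fi0 comp0m.
  by rewrite -(tU a erefl) -(tU b (esym iab)).
exists (G K), (eta X \oc fmap G i); split.
  by rewrite compA -eta_nat /= -compA -fmap_comp fi0 linear_functor0 // compm0.
move=> Z h fh0.
have [|t [it _]] := iU (F Z) (fmap F h).
  by rewrite -fmap_comp fh0 linear_functor0.
have [e [e1 e2]] := eta_iso Z.
exists (fmap G t \oc e); split.
  rewrite compA -[(eta X \oc _) \oc _]compA -fmap_comp it eta_nat /=.
  by rewrite -compA e2 compm1.
move=> s es; apply: F_inj.
have [d [d1 d2]] := th_iso K.
apply: (split_mono_cancel d1); apply: i_mono.
rewrite !compA -th_nat /=.
have eFG (a b : hom Z (G K)) : eta X \oc fmap G i \oc a = eta X \oc fmap G i \oc b ->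
    fmap F (fmap G i) \oc fmap F a = fmap F (fmap G i) \oc fmap F b.
  have [x [x1 _]] := eta_iso X.
  rewrite -!compA => /(split_mono_cancel x1) ab; by rewrite -!fmap_comp ab.
rewrite -!compA; congr (_ \oc _); apply: eFG; rewrite es.
rewrite compA -[(eta X \oc _) \oc _]compA -fmap_comp it eta_nat /=.
by rewrite -compA e2 compm1.
Qed.

Lemma tenm0 (k : fieldType) (C : moncat k) (X X' Y Y' : C) (f : hom X X') :
  f \om (0 : hom Y Y') = 0.
Proof.
have := tenm_linr (-1) f (0 : hom Y Y') 0.
by rewrite scaler0 addr0 scaleN1r addNr.
Qed.

Lemma compBm (k : fieldType) (C : lincat k) (X Y Z : C) (g g' : hom Y Z) (f : hom X Y) :
  (g - g') \oc f = (g \oc f) - (g' \oc f).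
Proof.
by rewrite addrC -scaleN1r comp_linl scaleN1r addrC.
Qed.

Section InternalHom.
Context (k : fieldType) (C : moncat k) (A : algebra C).

Lemma rmhomE (M N : rmodule A) (f : rmhom M N) :
  rmhom_val f \oc ract M = ract N \oc (rmhom_val f \om idm A).
Proof. by have := rmhom_valP f; rewrite unfold_in => /eqP. Qed.

Lemma rmhomP (M N : rmodule A) (f : @hom k C M N) :
  f \oc ract M = ract N \oc (f \om idm A) -> f \in rmhom_pred (M := M) (N := N).
Proof. by move=> E; rewrite unfold_in; apply/eqP. Qed.

Lemma lact_hom_comp (X X' X'' : C) (M M' M'' : rmod_cat A) (x : hom X X') (x' : hom X' X'')
    (f : hom M M') (f' : hom M' M'') :
  lact_hom x' f' \oc lact_hom x f = lact_hom (x' \oc x) (f' \oc f).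
Proof. by apply: val_inj; rewrite /= tenm_comp. Qed.

Lemma lact_hom_id (X : C) (M : rmod_cat A) : lact_hom (idm X) (idm M) = idm (lact X M :
  rmod_cat A).
Proof. by apply: val_inj; rewrite /= tenm_id. Qed.

Definition ihom_universal (M N : rmod_cat A) (K : C) (u : hom (lact K M : rmod_cat A) N) :=
  forall (X : C) (h : hom (lact X M : rmod_cat A) N),
    exists! t : hom X K, u \oc lact_hom t (idm M) = h.

(** Morphisms from [X \ox M] to [N] in the base category are morphisms from [X] to [N \ox L], with
    [L] the left dual of [M]. Linearity is the vanishing of a defect natural in [X], hence
    represented by a morphism out of [N \ox L]; its kernel is the internal Hom. *)
Lemma ihom_universal_exists (M N : rmod_cat A) :
  rigid C -> has_kernels C -> exists (K : C) (u : hom (lact K M : rmod_cat A) N),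
    ihom_universal u.
Proof.
move=> rigC kerC.
have [[L [ev [coev [zR zL]]]] _] := rigC M.
have [[L' [ev' [coev' [zR' zL']]]] _] := rigC (rm_obj M \ox A).
(* The defect of linearity, p(x, m a) - p(x, m) a. *)
pose del X (p : hom (X \ox rm_obj M) (rm_obj N)) : hom (X \ox (rm_obj M \ox A)) (rm_obj N)
  :=
  (p \oc (X \lw ract M)) - (ract N \oc op21 p A).
have del_comp X X' (p : hom (X \ox rm_obj M) (rm_obj N)) (x : hom X' X) :
    del X' (p \oc (x \om idm M)) = del X p \oc (x \om idm (rm_obj M \ox A)).
  rewrite /del -op21_l compBm -!compA; congr (_ - _).
  by rewrite -interchange.
have delP X (p : hom (X \ox rm_obj M) (rm_obj N)) :
    del X p = 0 <-> p \oc lact_ract X M = ract N \oc (p \om idm A).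
  have -> : p \om idm A = op21 p A \oc assoc X M A by rewrite op21E -compA assocK compm1.
  rewrite /lact_ract !compA /del; split=> [/eqP|E].
    by rewrite subr_eq0 => /eqP ->.
  by apply/eqP; rewrite subr_eq0; apply/eqP/(split_epi_cancel (assocIK _ _ _) E).
(* The generic morphism, mate of the identity: all others are pulled back from it, so its defect
   determines every defect. *)
pose p0 := evr ev (idm (rm_obj N \ox L)).
have evrE X (t : hom X (rm_obj N \ox L)) : evr ev t = p0 \oc (t \om idm M).
  by rewrite -evr_comp comp1m.
pose d := coevr coev' (del _ p0).
have dE X (t : hom X (rm_obj N \ox L)) : del X (evr ev t) = evr ev' (d \oc t).
  by rewrite evrE del_comp evr_comp coevrK.
have [K [i [di0 iU]]] := kerC _ _ d.
have uP : evr ev i \in rmhom_pred (M := lact K M) (N := N).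
  by apply: rmhomP; apply/delP; rewrite dE di0 evr0.
exists K, (RMHom uP) => X h.
have dh0 : d \oc coevr coev (rmhom_val h) = 0.
  apply: (evr_inj zL'); rewrite -dE coevrK // evr0.
  by apply/delP; exact: (rmhomE h).
have [t [it tU]] := iU X _ dh0; exists t; split.
  by apply: val_inj; rewrite /= -evr_comp it coevrK.
move=> t' t'h; apply: tU; apply: (evr_inj zL); rewrite coevrK // evr_comp.
by rewrite -t'h.
Qed.

Section Build.
Variables (K : rmod_cat A -> rmod_cat A -> C)
  (u : forall M N, hom (lact (K M N) M : rmod_cat A) N)
  (adj : forall (X : C) (M N : rmod_cat A), hom (lact X M : rmod_cat A) N -> hom X (K M N)).
Hypothesis adjE : forall (X : C) (M N : rmod_cat A) (h : hom (lact X M : rmod_cat A) N),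
  u M N \oc lact_hom (adj h) (idm M) = h.
Hypothesis adjU : forall (X : C) (M N : rmod_cat A) (t : hom X (K M N)),
  adj (u M N \oc lact_hom t (idm M)) = t.

Let map (M M' N N' : rmod_cat A) (f : hom M' M) (g : hom N N') : hom (K M N) (K M' N') :=
  adj (g \oc u M N \oc lact_hom (idm (K M N)) f).

Let adj_nat (X X' : C) (M M' N N' : rmod_cat A) (x : hom X' X) (f : hom M' M) (g : hom N N')
    (h : hom (lact X M : rmod_cat A) N) :
  adj (g \oc h \oc lact_hom x f) = map f g \oc adj h \oc x.
Proof.
rewrite -[RHS]adjU -[map f g \oc _ \oc x]compA; congr adj.
rewrite -[idm M']comp1m -lact_hom_comp compA adjE -!compA lact_hom_comp.
rewrite comp1m compm1 -[X in lact_hom (_ \oc x) X]comp1m -lact_hom_comp.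
by rewrite [u M N \oc _]compA adjE.
Qed.

Lemma build_internal_hom : inhabited (internal_hom A).
Proof.
constructor; refine (@InternalHom k C A K map _ _ adj _ adj_nat).
- by move=> M N; rewrite /map comp1m adjU.
- move=> M M' M'' N N' N'' f f' g g'.
  rewrite -[map f g]compm1 compA -adj_nat; congr adj.
  by rewrite -!compA lact_hom_comp comp1m.
- by move=> X M N; exists (fun t => u M N \oc lact_hom t (idm M)).
Qed.

End Build.

Lemma internal_hom_exists : rigid C -> has_kernels C -> inhabited (internal_hom A).
Proof.
move=> rigC kerC.
have rep (M N : rmod_cat A) := cid (ihom_universal_exists M N rigC kerC).
pose K (M N : rmod_cat A) := sval (rep M N).
pose U (M N : rmod_cat A) := cid (svalP (rep M N)).
pose u (M N : rmod_cat A) : hom (lact (K M N) M : rmod_cat A) N := sval (U M N).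
have uU (M N : rmod_cat A) : ihom_universal (u M N) := svalP (U M N).
pose adj (X : C) (M N : rmod_cat A) (h : hom (lact X M : rmod_cat A) N) := sval (cid (uU M
  N X h)).
have adjP (X : C) (M N : rmod_cat A) (h : hom (lact X M : rmod_cat A) N) := svalP (cid (uU
  M N X h)).
apply: (@build_internal_hom K u adj) => X M N h; first by case: (adjP X M N h).
by have [_] := adjP X M N (u M N \oc lact_hom h (idm M)); apply.
Qed.

Section Adjunction.
Variable G : internal_hom A.
Implicit Types M N : rmod_cat A.

Lemma ihom_counit M N : exists u : hom (lact (ihom G M N) M : rmod_cat A) N,
  forall X (t : hom X (ihom G M N)), ihom_adj G (u \oc lact_hom t (idm M)) = t.
Proof.
have [inv adjK invK] := ihom_adj_bij G (ihom G M N) M N.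
exists (inv (idm (ihom G M N))) => X t.
by rewrite -[inv _]comp1m ihom_adj_nat ihom_id comp1m invK comp1m.
Qed.

Definition ihom_ev M N := sval (cid (ihom_counit M N)).

Lemma ihom_evK M N X (t : hom X (ihom G M N)) :
  ihom_adj G (ihom_ev M N \oc lact_hom t (idm M)) = t.
Proof. exact: (svalP (cid (ihom_counit M N))). Qed.

Lemma ihom_adjK M N X (h : hom (lact X M : rmod_cat A) N) :
  ihom_ev M N \oc lact_hom (ihom_adj G h) (idm M) = h.
Proof. by apply: (bij_inj (ihom_adj_bij G X M N)); rewrite ihom_evK. Qed.

Lemma ihom_ev_inj M N X (t t' : hom X (ihom G M N)) :
  ihom_ev M N \oc lact_hom t (idm M) = ihom_ev M N \oc lact_hom t' (idm M) -> t = t'.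
Proof. by move=> /(congr1 (@ihom_adj _ _ _ G _ _ _)); rewrite !ihom_evK. Qed.

Lemma ihom_ev_map M M' N (f : hom M' M) X (t : hom X (ihom G M N)) :
  ihom_ev M' N \oc lact_hom (ihom_map G f (idm N) \oc t) (idm M') =
  ihom_ev M N \oc lact_hom t (idm M) \oc lact_hom (idm X) f.
Proof.
apply: (bij_inj (ihom_adj_bij G X M' N)); rewrite ihom_evK.
by rewrite -[ihom_ev M N \oc _]comp1m ihom_adj_nat ihom_evK compm1.
Qed.

(** Tested against [ihom_ev], the map induced by [f] is precomposition with [X \ox f], which is
    additive in [f]. *)
Lemma ihom_map_additive N : additive_functor (ihom_to G N).
Proof.
move=> M M' f g /=; apply: ihom_ev_inj.
have addl X Y (t t' : hom X Y) (P : rmod_cat A) :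
    lact_hom (t + t') (idm P) = lact_hom t (idm P) + lact_hom t' (idm P).
  by apply: val_inj; rewrite /= -[t]scale1r tenm_linl !scale1r.
have addr (X : C) (P Q : rmod_cat A) (a b : hom P Q) :
    lact_hom (idm X) (a + b) = lact_hom (idm X) a + lact_hom (idm X) b.
  by apply: val_inj; rewrite /= -[rmhom_val a]scale1r tenm_linr !scale1r.
have addc (P Q R : rmod_cat A) (a : hom Q R) (b b' : hom P Q) :
    a \oc (b + b') = (a \oc b) + (a \oc b').
  by rewrite -[b]scale1r comp_linr !scale1r.
rewrite addl addc -[ihom_map G f _]compm1 -[ihom_map G g _]compm1 -[ihom_map G (f + g)
  _]compm1.
by rewrite !ihom_ev_map -addc -addr.
Qed.

End Adjunction.

End InternalHom.

(** * Exactness *)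

Section LeftExact.
Context (k : fieldType) (C : moncat k) (A : algebra C).
Notation I := (unit_obj C).

(** This lifts the adjunction between [L \ox -] and [R \ox -] to modules: taking the mate of either
    side of one equation gives the corresponding side of the other, up to an invertible
    associator. *)
Lemma evl_linear (L R : C) (ev : hom (L \ox R) I) (coev : hom I (R \ox L))
    (M N : rmodule A) (s : hom (rm_obj M) (R \ox rm_obj N)) :
  runit R \oc (R \lw ev) \oc assoc R L R \oc (coev \om idm R) = lunit R ->
  s \oc ract M = lact_ract R N \oc (s \om idm A) <->
  evl ev s \oc lact_ract L M = ract N \oc (evl ev s \om idm A).
Proof.
move=> zR.
have E : evl ev (lact_ract R N \oc (s \om idm A)) = ract N \oc op21 (evl ev s) A.
  rewrite op21_evl op12E /lact_ract {1}/evl !lw_comp op20E -!compA.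
  by rewrite (comp_ext (assocI_lw _ _ _)) -!compA (comp_ext (interchange _ _)) -!compA
    (comp_ext (lunit_nat _)) -!compA.
have -> : evl ev s \om idm A = op21 (evl ev s) A \oc assoc L M A.
  by rewrite op21E -compA assocK compm1.
rewrite /lact_ract !compA -evl_comp; split=> [->|]; first by rewrite E.
move=> /(split_epi_cancel (assocIK _ _ _)); rewrite -E.
exact: (evl_inj zR).
Qed.

Variable G : internal_hom A.

(** A morphism from [X] to the internal Hom of [M] and [N] is a linear map from [X \ox M] to [N],
    hence a linear map from [M] to [Xr \ox N] with [Xr] the right dual of [X], naturally in [M]. The
    kernel property tested on [X] is the cokernel property of [g] tested on [Xr \ox N]. *)
Lemma ihom_left_exact (N M1 M2 M3 : rmod_cat A) (f : hom M1 M2) (g : hom M2 M3) :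
  rigid C -> is_cokernel g f -> is_kernel (ihom_map G g (idm N)) (ihom_map G f (idm N)).
Proof.
move=> rigC [gf0 gU].
have g_epi (P : rmod_cat A) (a b : hom M3 P) : a \oc g = b \oc g -> a = b.
  move=> ab; have [|t [_ tU]] := gU P (a \oc g); first by rewrite -compA gf0 compm0.
  by rewrite -(tU a erefl) -(tU b (esym ab)).
split.
  rewrite -ihom_comp comp1m gf0.
  have E (M M' : rmod_cat A) : ihom_map G (0 : hom M M') (idm N) = 0.
    have /= := @ihom_map_additive k C A G N M' M 0 0.
    by rewrite addr0 => e; apply: (@addrI _ (ihom_map G 0 (idm N))); rewrite addr0 -e.
  exact: E.
move=> X s fs0.
have [_ [Xr [ev [coev [zR zL]]]]] := rigC X.
have lin (M : rmod_cat A) (a : hom M (lact Xr N : rmod_cat A)) :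
    evl ev (rmhom_val a) \in rmhom_pred (M := lact X M) (N := N).
  by apply: rmhomP; apply/(evl_linear _ zR); exact: (rmhomE a).
pose E (M : rmod_cat A) (a : hom M (lact Xr N : rmod_cat A)) :
  hom (lact X M : rmod_cat A) N := RMHom (lin M a).
have E_comp (M M' : rmod_cat A) (a : hom M (lact Xr N : rmod_cat A)) (b : hom M' M) :
    E M' (a \oc b) = E M a \oc lact_hom (idm X) b.
  by apply: val_inj; rewrite /= evl_comp.
have E_inj (M : rmod_cat A) (a b : hom M (lact Xr N : rmod_cat A)) : E M a = E M b -> a = b.
  by move=> /(congr1 (@rmhom_val _ _ _ _ _)) /= ab; apply: val_inj; exact: (evl_inj zR ab).
have E_surj (M : rmod_cat A) (h : hom (lact X M : rmod_cat A) N) : exists a, E M a = h.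
  have cP : coevl coev (rmhom_val h) \in rmhom_pred (M := M) (N := lact Xr N).
    apply: rmhomP; apply/(evl_linear _ zR); rewrite coevlK //; exact: (rmhomE h).
  by exists (RMHom cP); apply: val_inj; rewrite /= coevlK.
have [a aE] := E_surj _ (ihom_ev G M2 N \oc lact_hom s (idm M2)).
have af0 : a \oc f = 0.
  apply: E_inj; rewrite E_comp aE -ihom_ev_map fs0.
  have -> : lact_hom (0 : hom X (ihom G M1 N)) (idm M1) = 0.
    by apply: val_inj; rewrite /= ten0m.
  rewrite compm0; apply: val_inj; rewrite /= /evl.
  by rewrite tenm0 compm0.
have [b [bg _]] := gU _ a af0.
exists (ihom_adj G (E M3 b)); split.
  by apply: ihom_ev_inj; rewrite ihom_ev_map ihom_adjK -E_comp bg.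
move=> t ts; apply: ihom_ev_inj; rewrite ihom_adjK.
have [b' b'E] := E_surj _ (ihom_ev G M3 N \oc lact_hom t (idm M3)).
rewrite -b'E; congr E; apply: g_epi; apply: E_inj.
by rewrite bg aE -ts ihom_ev_map -b'E E_comp.
Qed.

End LeftExact.

(** A test morphism [h] is extended along [rY], factored through the larger cokernel and restricted
    along [iQ]. A competitor composed with [rQ] factors the same extension, which gives
    uniqueness. *)
Lemma retract_cokernel (k : fieldType) (C : lincat k) (X Y Q X' Y' Q' : C)
    (f : hom X Y) (g : hom Y Q) (f' : hom X' Y') (g' : hom Y' Q')
    (iX : hom X X') (iY : hom Y Y') (iQ : hom Q Q')
    (rX : hom X' X) (rY : hom Y' Y) (rQ : hom Q' Q) :
  rY \oc iY = idm Y -> rQ \oc iQ = idm Q ->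
  iY \oc f = f' \oc iX -> iQ \oc g = g' \oc iY ->
  rY \oc f' = f \oc rX -> rQ \oc g' = g \oc rY ->
  is_cokernel g' f' -> is_cokernel g f.
Proof.
move=> rYi rQi iYf iQg rYf rQg [gf0 gU]; split.
  apply: (split_mono_cancel rQi).
  by rewrite (comp_ext iQg) -compA iYf (comp_ext gf0) comp0m compm0.
move=> Z h hf0.
have [|t [tg tU]] := gU Z (h \oc rY); first by rewrite -compA rYf compA hf0 comp0m.
exists (t \oc iQ); split; first by rewrite -compA iQg compA tg -compA rYi compm1.
move=> s sg; rewrite (tU (s \oc rQ)); first by rewrite -compA rQi compm1.
by rewrite -compA rQg compA sg.
Qed.

Section RightExact.
Context (k : fieldType) (C : moncat k) (A : algebra C).

Lemma kernel_mono (D : lincat k) (X Y Z : D) (f : hom X Y) (g : hom Y Z) :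
  is_kernel f g -> mono f.
Proof.
move=> [gf0 fU] W a b ab.
have [|t [_ tU]] := fU W (f \oc a); first by rewrite compA gf0 comp0m.
by rewrite -(tU a erefl) -(tU b (esym ab)).
Qed.

(* The forgetful functor is right adjoint to X |-> X (x) A. *)
Lemma forget_kernel (M1 M2 M3 : rmod_cat A) (f : hom M1 M2) (g : hom M2 M3) :
  is_kernel f g -> @is_kernel k C (rm_obj M1) (rm_obj M2) (rm_obj M3) (rmhom_val f)
    (rmhom_val g).
Proof.
move=> kf; have f_mono := kernel_mono kf; case: kf => gf0 fU.
have freeP (V : C) (M : rmod_cat A) (s : hom V (rm_obj M)) :
    ract M \oc (s \om idm A) \in rmhom_pred (M := lact V (regular_rmodule A)) (N := M).
  apply: rmhomP; rewrite /= /lact_ract rw_comp compA ractA -!compA; congr (_ \oc _).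
  by rewrite assoc_rw (comp_ext (esym (interchange s (amul A)))) -!compA.
pose free (V : C) (M : rmod_cat A) (s : hom V (rm_obj M)) :
  hom (lact V (regular_rmodule A) : rmod_cat A) M := RMHom (freeP V M s).
have freeK (V : C) (M : rmod_cat A) (s : hom V (rm_obj M)) :
    rmhom_val (free V M s) \oc ((V \lw aunit A) \oc runitI V) = s.
  rewrite /= -!compA (comp_ext (interchange s (aunit A))) -!compA runitI_nat.
  by rewrite (comp_ext (ract1 M)) compA runitIK comp1m.
have free_comp (V : C) (M M' : rmod_cat A) (a : hom M M') (s : hom V (rm_obj M)) :
    a \oc free V M s = free V M' (rmhom_val a \oc s).
  by apply: val_inj; rewrite /= compA rmhomE rw_comp -!compA.
split; first by rewrite -[LHS]/(rmhom_val (g \oc f)) gf0.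
move=> V s gs0.
have gfree0 : g \oc free V M2 s = 0.
  by rewrite free_comp; apply: val_inj; rewrite /= gs0 ten0m compm0.
have [t [ft _]] := fU _ _ gfree0.
exists (rmhom_val t \oc ((V \lw aunit A) \oc runitI V)); split.
  by rewrite compA -[rmhom_val f \oc _]/(rmhom_val (f \oc t)) ft freeK.
move=> s' fs'.
have -> : t = free V M1 s' by apply: f_mono; rewrite ft free_comp fs'.
by rewrite freeK.
Qed.

End RightExact.

Section Transpose.
Context (k : fieldType) (C : moncat k).
Notation I := (unit_obj C).
Variables (L : C -> C) (ev : forall M, hom (L M \ox M) I) (coev : forall M, hom I (M \ox L
  M)).
Hypothesis zigR : forall M,
  runit M \oc (M \lw ev M) \oc assoc M (L M) M \oc (coev M \om idm M) = lunit M.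
Hypothesis zigL : forall M,
  lunit (L M) \oc (ev M \om idm (L M)) \oc assocI (L M) M (L M) \oc (L M \lw coev M) =
  runit (L M).

Definition transpose (M M' : C) (f : hom M' M) : hom (L M) (L M') :=
  sval (cid (pair_left (zigR M') (ev M \oc (L M \lw f)))).

Lemma transposeE (M M' : C) (f : hom M' M) :
  ev M' \oc (transpose f \om idm M') = ev M \oc (L M \lw f).
Proof. exact: (svalP (cid (pair_left _ _))). Qed.

Lemma evr_transpose (V X M M' : C) (f : hom M' M) (t : hom X (V \ox L M)) :
  evr (ev M') ((V \lw transpose f) \oc t) = evr (ev M) t \oc (X \lw f).
Proof.
rewrite /evr rw_comp -!compA (comp_ext (assoc_nat _ _ _)) -!compA.
rewrite (comp_ext (lw_eq _ (transposeE f))) !lw_comp -!compA.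
by rewrite (interchange t f) (comp_ext (assoc_lw _ _ _)) -!compA.
Qed.

(** Maps from [V \ox L M] to [Z] are maps from [L M] to [W], and these are maps from the right dual
    [Wr] of [W] to [M], naturally in [M]. The cokernel test on [Z] thus becomes the kernel test on
    [Wr]. *)
Lemma transpose_cokernel (V M1 M2 M3 : C) (f : hom M1 M2) (g : hom M2 M3) :
  rigid C -> is_kernel f g -> is_cokernel (V \lw transpose f) (V \lw transpose g).
Proof.
move=> rigC kf; have f_mono := kernel_mono kf; case: kf => gf0 fU; split.
  apply: (evr_inj (zigL M1)); rewrite evr_transpose -[V \lw transpose g]compm1.
  by rewrite evr_transpose -compA -lw_comp gf0 tenm0 compm0 evr0.
move=> Z h hg0.
have [_ [Vr [evV [coevV [zR zL]]]]] := rigC V.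
set W := Vr \ox Z.
have [_ [Wr [evW [coevW [zRW zLW]]]]] := rigC W.
(* Maps L M -> W correspond to maps Wr -> M through the pairings. *)
have corr (M : C) (t : hom (L M) W) : exists s : hom Wr M,
    ev M \oc (L M \lw s) = evW \oc (t \om idm Wr).
  exact: (pair_right (zigL M)).
have corr' (M : C) (s : hom Wr M) : exists t : hom (L M) W,
    ev M \oc (L M \lw s) = evW \oc (t \om idm Wr).
  by have [t ts] := pair_left zRW (ev M \oc (L M \lw s)); exists t.
have corr_nat (M M' : C) (a : hom M' M) (s : hom Wr M') (t : hom (L M') W) :
    ev M' \oc (L M' \lw s) = evW \oc (t \om idm Wr) ->
    ev M \oc (L M \lw (a \oc s)) = evW \oc ((t \oc transpose a) \om idm Wr).
  move=> st; rewrite rw_comp compA -st lw_comp compA -transposeE -!compA.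
  by rewrite interchange.
have [s sP] := corr M2 (coevl coevV h).
have gs0 : g \oc s = 0.
  apply: (pair_right_inj (zigR M3)).
  by rewrite (corr_nat _ _ _ _ _ sP) -(coevl_comp zR zL) hg0 tenm0 /coevl tenm0 !comp0m
    ten0m !compm0.
have [s' [fs' _]] := fU _ s gs0.
have [t tP] := corr' M1 s'.
have tf : t \oc transpose f = coevl coevV h.
  apply: (pair_left_inj zLW).
  by rewrite -(corr_nat _ _ f _ _ tP) fs' sP.
exists (evl evV t); split; first by rewrite -evl_comp tf coevlK.
move=> t' t'f; rewrite -(coevlK zL t'); congr evl.
have [s2 s2P] := corr M1 (coevl coevV t').
have s2s : s2 = s'.
  apply: f_mono; rewrite fs'; apply: (pair_right_inj (zigR M2)).
  by rewrite (corr_nat _ _ f _ _ s2P) sP -(coevl_comp zR zL) t'f.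
by apply: (pair_left_inj zLW); rewrite -s2P -tP s2s.
Qed.

End Transpose.

(** * The internal Hom into the regular module as a retract of a dual *)

Section RegularModule.
Context (k : fieldType) (C : moncat k) (c : braiding C) (H : hopf_algebra c).
Notation I := (unit_obj C).
Variable G : internal_hom H.
Notation reg := (regular_rmodule H : rmod_cat H).
Variables (L : C -> C) (ev : forall M, hom (L M \ox M) I) (coev : forall M, hom I (M \ox L
  M)).
Hypothesis zigR : forall M,
  runit M \oc (M \lw ev M) \oc assoc M (L M) M \oc (coev M \om idm M) = lunit M.
Hypothesis zigL : forall M,
  lunit (L M) \oc (ev M \om idm (L M)) \oc assocI (L M) M (L M) \oc (L M \lw coev M) =
  runit (L M).

Implicit Types M : rmod_cat H.

Let hH : C := alg_obj H.
Let F M : C := hH \ox L (rm_obj M).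
Let r M (phi : hom (rm_obj M) hH) : hom M reg :=
  RMHom (rmhomP (N := reg) (retr_act (zigR hH) (zigL hH) phi)).

Let Fmap M M' (f : hom M' M) : hom (F M) (F M') := hH \lw transpose zigR (rmhom_val f).

(** On morphisms out of [X] this is the inclusion of the linear maps from [X \ox M] to [H] among all
    maps. *)
Definition ihom_to_dual M : hom (ihom G M reg) (F M) :=
  coevr (coev (rm_obj M)) (rmhom_val (ihom_ev G M reg)).

(** The operator [retr] on representing objects: by naturality it suffices to apply it to the
    generic map, the mate of the identity of [F M]. *)
Definition dual_to_ihom M : hom (F M) (ihom G M reg) :=
  ihom_adj G (r (M := lact (F M) M) (evr (ev (rm_obj M)) (idm (F M)))).

Lemma evr_ihom_to_dual M X (t : hom X (ihom G M reg)) :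
  evr (ev (rm_obj M)) (ihom_to_dual M \oc t) =
  rmhom_val (ihom_ev G M reg \oc lact_hom t (idm M)).
Proof. by rewrite evr_comp coevrK. Qed.

Lemma ihom_ev_dual_to_ihom M X (t : hom X (F M)) :
  ihom_ev G M reg \oc lact_hom (dual_to_ihom M \oc t) (idm M) =
  r (M := lact X M) (evr (ev (rm_obj M)) t).
Proof.
rewrite -[idm M]comp1m -lact_hom_comp compA ihom_adjK; apply: val_inj => /=.
rewrite -(retr_nat _ _ (Y := lact (F M) M) (Y' := lact X M) _) -?evr_comp ?comp1m //.
exact: (rmhomE (lact_hom t (idm M) : rmhom _ _)).
Qed.

Lemma ihom_to_dualK M : dual_to_ihom M \oc ihom_to_dual M = idm (ihom G M reg).
Proof.
apply: ihom_ev_inj; rewrite ihom_ev_dual_to_ihom lact_hom_id compm1.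
rewrite -[ihom_to_dual M]compm1 evr_ihom_to_dual lact_hom_id compm1.
apply: val_inj; apply: retr_id => //.
exact: (rmhomE (ihom_ev G M reg)).
Qed.

Lemma ihom_to_dual_nat M M' (f : hom M' M) :
  ihom_to_dual M' \oc ihom_map G f (idm reg) = Fmap f \oc ihom_to_dual M.
Proof.
apply: (evr_inj (zigL (rm_obj M'))); rewrite evr_transpose.
rewrite evr_ihom_to_dual -[ihom_map G f _]compm1 ihom_ev_map.
by rewrite -[ihom_to_dual M]compm1 evr_ihom_to_dual.
Qed.

Lemma dual_to_ihom_nat M M' (f : hom M' M) :
  dual_to_ihom M' \oc Fmap f = ihom_map G f (idm reg) \oc dual_to_ihom M.
Proof.
apply: ihom_ev_inj; rewrite ihom_ev_dual_to_ihom ihom_ev_map.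
rewrite -[dual_to_ihom M]compm1 ihom_ev_dual_to_ihom; apply: val_inj => /=.
rewrite -(retr_nat _ _ (Y := lact (F M) M) (Y' := lact (F M) M') _).
  by rewrite -[Fmap f]compm1 evr_transpose.
exact: (rmhomE (lact_hom (idm (F M)) f : rmhom _ _)).
Qed.

Lemma ihom_regular_right_exact M1 M2 M3 (f : hom M1 M2) (g : hom M2 M3) :
  rigid C -> is_kernel f g ->
  is_cokernel (ihom_map G f (idm reg)) (ihom_map G g (idm reg)).
Proof.
move=> rigC kf.
apply: (retract_cokernel (ihom_to_dualK _) (ihom_to_dualK _) (ihom_to_dual_nat g)
  (ihom_to_dual_nat f) (dual_to_ihom_nat g) (dual_to_ihom_nat f)).
exact/transpose_cokernel/forget_kernel.
Qed.

End RegularModule.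

Theorem theorem5p22 (k : fieldType) (C : braided_fin_tensor_cat k)
    (H : hopf_algebra (bft_braiding C)) :
  quasi_frobenius H.
Proof.
have [finC rigC _] := bft_fin_tensor C.
have kerC : has_kernels C.
  by have [A CA] := finC; apply: equivalent_kernels CA _; exact: fdmod_kernels.
have [G] := internal_hom_exists H rigC kerC; exists G; split.
  exact: ihom_map_additive.
(* Arrows of the opposite category run backwards: as module maps, [f] goes from [M1] to [M2] and [g]
   from [M2] to [M3]. Hence [gker] says that [g] is a cokernel of [f], and [gcoker] that [f] is a
   kernel of [g]. *)
move=> M3 M2 M1 g f [gker gcoker]; split; first exact: ihom_left_exact.
(* Rigidity asserts existence object by object; the duals are chosen here so that [M] determines its
   dual, as [transpose] requires. *)
have dual (M : C) : {L : C & {ev : hom (L \ox M) (unit_obj C) &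
    {coev : hom (unit_obj C) (M \ox L) |
    runit M \oc (M \lw ev) \oc assoc M L M \oc (coev \om idm M) = lunit M /\
    lunit L \oc (ev \om idm L) \oc assocI L M L \oc (L \lw coev) = runit L}}}.
  have [/cid[L /cid[ev /cid[coev zz]]] _] := rigC M.
  by exists L, ev, coev.
apply: (@ihom_regular_right_exact k C _ H G (fun M => projT1 (dual M))
  (fun M => projT1 (projT2 (dual M))) (fun M => sval (projT2 (projT2 (dual M))))) => //.
- by move=> M; case: (svalP (projT2 (projT2 (dual M)))).
- by move=> M; case: (svalP (projT2 (projT2 (dual M)))).
Qed.
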